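(* Let $n\ge 1$, $\delta>0$ and $\beta<n+2$. Let $$\lambda_2(\nu)=-\mu\|\nu\|^2\;{}_2F_3\left(1,\tfrac{n+2-\beta}{2};\,2,\tfrac{n+4}{2},\tfrac{n+4-\beta}{2};\,-\tfrac14\|\nu\|^2\delta^2\right),\qquad \nu\in\mathbb{R}^n .$$ Then, as $\|\nu\|\to\infty$, $$\lambda_2(\nu)\sim\begin{cases}\displaystyle -\mu\frac{2(n+2-\beta)(n+2)}{\delta^2(n-\beta)}-\mu\frac{\Gamma(\frac{n+4}{2})\Gamma(\frac{n+4-\beta}{2})}{\frac{\beta-n}{2}\,\Gamma(\frac{\beta+2}{2})}\left(\frac{2}{\delta}\right)^{n+2-\beta}\|\nu\|^{\beta-n} & \text{if }\beta\ne n,\\[2ex] \displaystyle -\frac{2\mu}{\delta^2}(n+2)\left(2\log\|\nu\|+\log\left(\frac{\delta^2}{4}\right)+\gamma-\psi\left(\frac{n+2}{2}\right)\right) & \text{if }\beta=n,\end{cases}$$ where $\gamma$ is Euler's constant and $\psi$ is the digamma function.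
   Context: The generalized hypergeometric function is ${}_pF_q(a_1,\dots,a_p;b_1,\dots,b_q;x)=\sum_{m\ge0}\frac{(a_1)_m\cdots(a_p)_m}{(b_1)_m\cdots(b_q)_m}\frac{x^m}{m!}$, with $(a)_m=a(a+1)\cdots(a+m-1)$. The Lamé parameter $\mu>0$ is a constant. $1/\Gamma$ is read as the entire function (value $0$ at nonpositive integers). $f(\nu)\sim g(\nu)$ as $\|\nu\|\to\infty$ means $f(\nu)/g(\nu)\to1$. ($\lambda_2(\nu)$ is the eigenvalue, on vectors orthogonal to $\nu$, of the Fourier multiplier of the linear state-based peridynamic operator with horizon $\delta$ and kernel exponent $\beta$.) *)

(* Defs.v *)
From mathcomp Require Import all_boot all_order all_algebra.
From mathcomp Require Import all_classical all_reals all_analysis.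
Set Implicit Arguments.
Unset Strict Implicit.
Unset Printing Implicit Defensive.
Import Order.TTheory GRing.Theory Num.Theory.
Import numFieldNormedType.Exports.
Local Open Scope classical_set_scope.
Local Open Scope ring_scope.

Definition rising {R : realType} (a : R) (m : nat) : R :=
  \prod_(i < m) (a + i%:R).

Definition hypergeometric {R : realType} (s t : seq R) (x : R) : R :=
  limn (pseries (fun m => (\prod_(a <- s) rising a m) /
                          (\prod_(b <- t) rising b m) / m`!%:R) x).

(* Euler's integral; it represents Gamma only for 0 < x, which covers every
   occurrence of Gamma itself (as opposed to 1/Gamma) below. *)
Definition Gamma {R : realType} (x : R) : R :=
  \int[@lebesgue_measure R]_(t in `]0, +oo[) (t `^ (x - 1) * expR (- t)).

(* The entire function 1/Gamma on the real line: by the functional equation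
   Gamma(x + k) = (x)_k Gamma(x), 1/Gamma(x) = (x)_k / Gamma(x + k) for any k
   with 0 < x + k. For x = -m the factor (x)_k contains x + m = 0. *)
Definition rGamma {R : realType} (x : R) : R :=
  let k := (Num.truncn `|x|).+1 in rising x k / Gamma (x + k%:R).

Definition digamma {R : realType} (x : R) : R :=
  derive1 (fun y : R => ln (Gamma y)) x.

Definition Euler_gamma {R : realType} : R :=
  limn (fun m : nat => \sum_(1 <= k < m.+1) (k%:R : R)^-1 - ln (m%:R : R)).

(* The library norm on row vectors is the sup norm. *)
Definition enorm {R : realType} {n : nat} (v : 'rV[R]_n) : R :=
  Num.sqrt (\sum_(i < n) v 0 i ^+ 2).

Definition enorm_infty {R : realType} {n : nat} : set_system 'rV[R]_n :=
  filter_from [set: R] (fun M => [set v | M < enorm v]).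

Global Instance enorm_infty_filter {R : realType} {n : nat} :
  Filter (@enorm_infty R n).
Proof.
apply: filter_from_filter; first by exists 0.
move=> M N _ _; exists (Num.max M N) => // v /=.
by rewrite gt_max => /andP[].
Qed.

Definition asymp_equiv {R : realType} {n : nat} (f g : 'rV[R]_n -> R) : Prop :=
  f v / g v @[v --> enorm_infty] --> (1 : R).

Definition lambda2 {R : realType} {n : nat} (mu delta beta : R)
    (nu : 'rV[R]_n) : R :=
  - mu * enorm nu ^+ 2 *
  hypergeometric [:: 1; (n%:R + 2 - beta) / 2]
                 [:: 2; (n%:R + 4) / 2; (n%:R + 4 - beta) / 2]
                 (- 4^-1 * enorm nu ^+ 2 * delta ^+ 2).

(* Main.v *)
Require Import Defs.
From mathcomp Require Import all_boot all_order all_algebra.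
From mathcomp Require Import all_classical all_reals all_analysis.
From mathcomp Require Import measurable_realfun ring lra.
Set Implicit Arguments.
Unset Strict Implicit.
Unset Printing Implicit Defensive.
Import Order.TTheory GRing.Theory Num.Theory.
Import numFieldNormedType.Exports.
Local Open Scope classical_set_scope.
Local Open Scope ring_scope.

(** Write r for the norm of nu, z = r^2 delta^2 / 4, a = (n + 2 - beta) / 2 > 0,
   c = (n + 2) / 2 >= 3/2, and J(x) = 0F1(; c; - x). The quotients of Pochhammer
   symbols 1 / (m + 1) and a / (a + m) in the 2F3 amount to an integration against
   a power (hypergeometric_mellin, lambda2E):

     lambda2(nu) = - mu (4 / delta^2) c a z^(1 - a) M(z),
     M(z) = integral of t^(a - 2) (1 - J(t)) over 0 < t < z.

   The asymptotics of M depend on whether the weight t^(a - 2) is integrable at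
   infinity, that is on the sign of a - 1 = (n - beta) / 2.

   The Bessel-Clifford function J solves x J'' + c J' + J = 0. Two energy
   arguments give |J| <= 1 (clifford_le1) and J -> 0 (clifford_cvg0); the second
   uses c >= 3/2.

   If a > 1, the integral diverges like that of t^(a - 2), and M(z) is equivalent to
   z^(a - 1) / (a - 1) (mellin_cvg_gt1); this is the constant term of the claim,
   the other one being negligible. If a = 1, M(z) is equivalent to ln z
   (mellin_cvg_eq1), and the constants gamma and psi((n + 2) / 2) are negligible.
   Both follow from l'Hopital's rule (cvg_div_of_derive_little).

   If a < 1, M increases to a finite limit K, and z^(1 - a) dominates the constant
   term. The claim is then that

     K = Gamma(c) Gamma(a) / ((1 - a) Gamma(c + 1 - a)),

   a value of the Mellin transform of J (mellin_clifford_cvgy). It is obtained by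
   averaging over the Gamma density: since the integral of s^(c + k - 1) e^-s is
   (c)_k Gamma(c), averaging s |-> J(s q) removes the factors (c)_k from the
   coefficients (-1)^k / (k! (c)_k) and leaves e^-q (laplace_psum), and the same
   holds after division of the coefficients by a - 1 + k. Letting q tend to
   infinity compares K to the corresponding limit for e^-x, which is
   Gamma(a) / (1 - a) by an integration by parts (mellin_expN_cvgy).

   J, e^-x and the functions z^(1 - a) M(z) are handled as entire series with
   O(1 / k!) coefficients, so that the differential equations, among them
   M' = z^(a - 2) (1 - J), are checked on coefficients, and the only integrals to
   be studied are those against Gamma densities. *)

(** * Entire power series *)

(** The coefficients that occur below are all O(1 / k!). This class is stable
   under formal differentiation, so termwise differentiation is always
   available, with no discussion of radii of convergence. *)
Definition factorially_bounded {R : realType} (u : nat -> R) : Prop :=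
  exists C : R, forall k, `|u k| * k`!%:R <= C.

Definition psum {R : realType} (u : nat -> R) (x : R) : R := limn (pseries u x).

Section EntireSeries.
Context {R : realType}.
Implicit Types (u v : nat -> R) (x y : R).

Lemma factorially_bounded_cvg u x :
  factorially_bounded u -> cvgn (pseries u x).
Proof.
move=> [C uC]; apply: normed_cvg => /=.
have C0 : 0 <= C by apply: le_trans (uC 0%N); rewrite mulr_ge0.
apply: (@series_le_cvg _ _ (fun k => C * exp_coeff `|x| k)) => //=.
- by move=> k; rewrite mulr_ge0// divr_ge0// exprn_ge0.
- move=> k; rewrite normrM normrX [leRHS]mulrA -mulrAC mulrC.
  by rewrite [leRHS]mulrC ler_wpM2l ?exprn_ge0// ler_pdivlMr ?ltr0n ?fact_gt0.
- exact: (@is_cvg_seriesZ _ _ C (is_cvg_series_exp_coeff `|x|)).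
Qed.

Lemma factorially_boundedD u v :
  factorially_bounded u -> factorially_bounded v ->
  factorially_bounded (fun k => u k + v k).
Proof.
move=> [C uC] [D vD]; exists (C + D) => k; apply: le_trans (lerD (uC k) (vD k)).
by rewrite -mulrDl ler_wpM2r// ler_normD.
Qed.

Lemma factorially_boundedZ a u :
  factorially_bounded u -> factorially_bounded (fun k => a * u k).
Proof.
move=> [C uC]; exists (`|a| * C) => k.
by rewrite normrM -mulrA ler_wpM2l.
Qed.

Lemma factorially_bounded_diffs u :
  factorially_bounded u -> factorially_bounded (pseries_diffs u).
Proof.
move=> [C uC]; exists C => k; apply: le_trans (uC k.+1).
by rewrite /pseries_diffs normrM normr_nat mulrAC mulrC factS natrM.
Qed.

Lemma factorially_bounded_shift u :
  factorially_bounded u -> factorially_bounded (fun k => u k.+1).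
Proof.
move=> [C uC]; exists C => k; apply: le_trans (uC k.+1).
by rewrite ler_wpM2l// ler_nat factS leq_pmull.
Qed.

Lemma psum_is_derive u x :
  factorially_bounded u -> is_derive x 1 (psum u) (psum (pseries_diffs u) x).
Proof.
move=> bu; apply: (@pseries_snd_diffs _ _ (`|x| + 1)).
- exact: factorially_bounded_cvg.
- exact/factorially_bounded_cvg/factorially_bounded_diffs.
- apply: factorially_bounded_cvg.
  exact/factorially_bounded_diffs/factorially_bounded_diffs.
- by rewrite [ltRHS]ger0_norm ?addr_ge0// ltrDl.
Qed.

Lemma psumD u v x : factorially_bounded u -> factorially_bounded v ->
  psum (fun k => u k + v k) x = psum u x + psum v x.
Proof.
move=> bu bv; rewrite /psum /pseries -lim_seriesD; last 2 first.
  exact: factorially_bounded_cvg.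
  exact: factorially_bounded_cvg.
by congr (limn (series _)); apply/funext => k; rewrite /= mulrDl.
Qed.

Lemma psumZ a u x : factorially_bounded u ->
  psum (fun k => a * u k) x = a * psum u x.
Proof.
move=> bu; rewrite /psum /pseries -[RHS](@lim_seriesZ _ _ a); last first.
  exact: factorially_bounded_cvg.
by congr (limn (series _)); apply/funext => k; rewrite /= -mulrA.
Qed.

(** Multiplication by the variable shifts the coefficients. The differential
   equations below are read off from this: x times a derived series is the
   series whose coefficients satisfy the recurrence. *)
Lemma psum_shift u v x : factorially_bounded u -> v 0%N = 0 ->
  (forall k, v k.+1 = u k) -> psum v x = x * psum u x.
Proof.
move=> bu v0 vS; rewrite /psum.
have cu : cvgn (series (x *: (fun k => u k * x ^+ k))).
  exact/is_cvg_seriesZ/factorially_bounded_cvg.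
rewrite -[RHS](@lim_seriesZ _ _ x); last exact: factorially_bounded_cvg.
apply/cvg_lim => //; rewrite -cvg_shiftS /=.
rewrite (_ : (fun n => _) = series (x *: (fun k => u k * x ^+ k))) //.
apply/funext => n; rewrite /pseries /series/= big_nat_recl//= v0 mul0r add0r.
by apply: eq_bigr => k _; rewrite vS exprS mulrCA.
Qed.

Lemma psum_at0 u : psum u 0 = u 0%N.
Proof.
apply/cvg_lim => //; rewrite -cvg_shiftS /= (_ : (fun n => _) = cst (u 0%N)).
  exact: cvg_cst.
apply/funext => n; rewrite /pseries /series/= big_nat_recl//= expr0 mulr1.
by rewrite big1 ?addr0// => k _; rewrite expr0n mulr0.
Qed.

Lemma psum_continuous u x : factorially_bounded u -> {for x, continuous (psum u)}.
Proof.
move=> bu; apply/differentiable_continuous/derivable1_diffP.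
by have [] := psum_is_derive x bu.
Qed.

End EntireSeries.

(** * Real calculus on the half-line *)

Section RealCalculus.
Context {R : realType}.
Implicit Types (f g df dg : R -> R) (a b p x y t : R).

Lemma derive_ge0_le f df a b : a <= b ->
  (forall x : R, a <= x <= b -> is_derive x 1 f (df x)) ->
  (forall x : R, a <= x <= b -> 0 <= df x) -> f a <= f b.
Proof.
move=> ab fd d0; have [||x xab fE] := @MVT_segment _ f df a b ab.
- by move=> x; rewrite in_itv/= => /andP[ax xb]; apply: fd; rewrite !ltW.
- apply: derivable_within_continuous => x; rewrite in_itv/= => xab.
  by have [] := fd _ xab.
by rewrite -subr_ge0 fE mulr_ge0 ?subr_ge0// d0// -in_itv.
Qed.

(** A pointwise bound between derivatives passes to increments: both g - f and
   g + f are nondecreasing. *)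
Lemma derive_norm_le f df g dg a b : a <= b ->
  (forall x : R, a <= x <= b -> is_derive x 1 f (df x)) ->
  (forall x : R, a <= x <= b -> is_derive x 1 g (dg x)) ->
  (forall x : R, a <= x <= b -> `|df x| <= dg x) -> `|f b - f a| <= g b - g a.
Proof.
move=> ab fd gd dfg.
have h1 : g a - f a <= g b - f b.
  apply: (@derive_ge0_le (fun x => g x - f x) (fun x => dg x - df x)) => // x xab.
    by have := fd x xab; have := gd x xab => ? ?; exact: is_deriveB.
  by rewrite subr_ge0; exact: le_trans (ler_norm _) (dfg x xab).
have h2 : g a + f a <= g b + f b.
  apply: (@derive_ge0_le (fun x => g x + f x) (fun x => dg x + df x)) => // x xab.
    by have := fd x xab; have := gd x xab => ? ?; exact: is_deriveD.
  by have := dfg x xab; rewrite ler_norml => /andP[]; lra.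
by rewrite ler_norml; lra.
Qed.

Lemma powRDgt0 p q r x : 0 < x -> p = q + r -> x `^ p = x `^ q * x `^ r.
Proof. by move=> x0 ->; rewrite powRD// (gt_eqF x0) implybT. Qed.

Lemma is_derive_powRM f (d p x : R) : 0 < x -> is_derive x 1 f d ->
  is_derive x 1 (fun y => y `^ p * f y) (x `^ (p - 1) * (p * f x + x * d)).
Proof.
move=> x0 fd; have px := is_derive1_powR p x0.
apply: is_derive_eq; rewrite /GRing.scale/=.
rewrite (@powRDgt0 p (p - 1) 1 x)// ?subrK// powRr1 ?ltW//; ring.
Qed.

Lemma ln_cvgy : (ln x : R) @[x --> +oo] --> +oo.
Proof.
apply/cvgryPge => M; near=> x.
by rewrite -[M]expRK ler_ln ?posrE ?expR_gt0.
Unshelve. all: by end_near. Qed.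

Lemma powR_cvgy p : 0 < p -> x `^ p @[x --> +oo] --> +oo.
Proof.
move=> p0; apply/cvgryPge => M; near=> x.
have M0 : 0 < Num.max M 1 by rewrite lt_max ltr01 orbT.
apply: (@le_trans _ _ (Num.max M 1)); first by rewrite le_max lexx.
rewrite -[leLHS]powRr1 ?(ltW M0)// -[X in _ `^ X](@mulVf _ p) ?gt_eqF// powRrM.
by apply: ge0_ler_powR; rewrite ?nnegrE ?powR_ge0// ltW.
Unshelve. all: by end_near. Qed.

Lemma powR_cvgy0 p : p < 0 -> x `^ p @[x --> +oo] --> (0 : R).
Proof.
move=> p0; have /(powR_cvgy) py : 0 < - p by rewrite oppr_gt0.
rewrite (_ : (fun x => _) = (fun x : R => (x `^ (- p))^-1)).
  apply/gtr0_cvgV0 => //; near=> x; exact: powR_gt0.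
by apply/funext => x; rewrite powRN invrK.
Unshelve. all: by end_near. Qed.

(** L'Hopital's rule at infinity in its oh form: once the derivatives satisfy
   |h'| <= e g', so do the increments, and g grows beyond the initial value
   of h. *)
Lemma cvg_div_of_derive_little (h g dh dg : R -> R) :
  (forall x, 0 < x -> is_derive x 1 h (dh x)) ->
  (forall x, 0 < x -> is_derive x 1 g (dg x)) ->
  g x @[x --> +oo] --> +oo ->
  (forall e : R, 0 < e -> \forall x \near +oo, `|dh x| <= e * dg x) ->
  h x / g x @[x --> +oo] --> (0 : R).
Proof.
move=> hd gd gy dhg; apply/cvgr0Pnorm_le => e e0.
have e20 : 0 < e / 2 by rewrite divr_gt0.
have [T0 [_ HT]] := dhg (e / 2) e20.
pose T := Num.max T0 0 + 1.
have T0T : T0 < T by rewrite /T ltr_pwDr// le_max lexx.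
have Tgt0 : 0 < T by rewrite /T ltr_pwDr// le_max lexx orbT.
near=> x.
have Tx : T <= x by [].
have gx0 : 0 < g x by near: x; move/cvgryPgt : gy; apply.
have gxT : `|h T| - e / 2 * g T <= e / 2 * g x.
  rewrite -ler_pdivrMl//; near: x; move/cvgryPge : gy; exact.
have : `|h x - h T| <= e / 2 * g x - e / 2 * g T.
  apply: (@derive_norm_le h dh (fun y => e / 2 * g y)
    (fun y => e / 2 * dg y) T x Tx) => y /andP[Ty yx].
  - exact/hd/(lt_le_trans Tgt0).
  - by have := gd y (lt_le_trans Tgt0 Ty) => ?; exact: is_deriveZ.
  - exact/HT/(lt_le_trans T0T).
move=> hT; rewrite normrM normfV (gtr0_norm gx0) ler_pdivrMr//.
have := ler_normD (h x - h T) (h T); rewrite subrK; lra.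
Unshelve. all: by end_near. Qed.

Lemma is_derive_continuous (f : R -> R) (x d : R) :
  is_derive x 1 f d -> {for x, continuous f}.
Proof.
by move=> [fd _]; apply/differentiable_continuous/derivable1_diffP.
Qed.

Lemma expR_ge_exp_coeff (y : R) k : 0 <= y -> y ^+ k / k`!%:R <= expR y.
Proof.
move=> y0; case: k => [|k].
  by rewrite expr0 fact0 divr1 -[leLHS]addr0 (le_trans _ (expR_ge1Dx _))// lerD2l.
by apply: le_trans (expR_ge1Dxn k y0); rewrite lerDr.
Qed.

Lemma expR_ge_partial_sum (y : R) n : 0 <= y ->
  \sum_(0 <= k < n) y ^+ k / k`!%:R <= expR y.
Proof.
move=> y0; apply: (@nondecreasing_cvgn_le _ (series (exp_coeff y))).
  by apply: nondecreasing_series => k _ _; exact: exp_coeff_ge0.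
exact: is_cvg_series_exp_coeff.
Qed.

(** An exponential beats every power, with a bound uniform down to t = 0. *)
Lemma powR_expRN_bounded (p theta : R) : 0 < theta ->
  exists C : R, forall t, 0 <= t -> (1 + t) `^ p * expR (- (theta * t)) <= C.
Proof.
move=> th0; pose N := (Num.truncn `|p|).+1.
have pN : p <= N%:R by rewrite (le_trans (ler_norm p))// ltW// truncnS_gt.
exists (N`!%:R * theta ^- N * expR theta) => t t0.
have t1 : 0 < 1 + t by rewrite ltr_pwDl.
rewrite expRN ler_pdivrMr ?expR_gt0//.
apply: (@le_trans _ _ ((1 + t) ^+ N)).
  by rewrite -powR_mulrn ?ler_powR ?(ltW t1)// lerDl.
rewrite -[leRHS]mulrA -expRD -[X in expR (X + _)]mulr1 -mulrDr.
have := expR_ge_exp_coeff N (mulr_ge0 (ltW th0) (ltW t1)).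
rewrite ler_pdivrMr ?ltr0n ?fact_gt0// exprMn => h.
by rewrite mulrAC ler_pdivlMr ?exprn_gt0// mulrC [leRHS]mulrC.
Qed.

Lemma cvg_mulrnat (s : R) : 0 < s -> s * n.+1%:R @[n --> \oo] --> +oo.
Proof.
move=> s0; apply/cvgryPge => M; near=> n; rewrite mulrC -ler_pdivrMr//.
rewrite (@le_trans _ _ n%:R) ?ler_nat//.
by near: n; exact: nbhs_infty_ger.
Unshelve. all: by end_near. Qed.

End RealCalculus.

(** * The Bessel-Clifford function *)

Section Rising.
Context {R : realType}.
Implicit Types a c : R.

Lemma risingS a k : rising a k.+1 = rising a k * (a + k%:R).
Proof. by rewrite /rising big_ord_recr. Qed.

Lemma risingSl a k : rising a k.+1 = a * rising (a + 1) k.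
Proof.
rewrite /rising big_ord_recl addr0; congr (_ * _); apply: eq_bigr => i _.
by rewrite -addrA nat1r.
Qed.

Lemma rising1 k : rising (1 : R) k = k`!%:R.
Proof.
elim: k => [|k IH]; first by rewrite /rising big_ord0.
by rewrite risingS IH factS natrM nat1r mulrC.
Qed.

Lemma rising_gt0 a k : 0 < a -> 0 < rising a k.
Proof. by move=> a0; apply: prodr_gt0 => i _; rewrite ltr_wpDr. Qed.

Lemma rising_ge_fact c k : 1 <= c -> k`!%:R <= rising c k.
Proof.
move=> c1; rewrite -rising1; apply: ler_prod => i _.
by rewrite addr_ge0// lerD2r.
Qed.

End Rising.

Section BesselClifford.
Context {R : realType}.

Implicit Types c x : R.

(** Coefficients of 0F1(; c; - x), which is x^((1 - c) / 2) J_(c - 1)(2 sqrt x)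
   up to the factor Gamma(c), J_(c - 1) being the Bessel function. *)
Definition clifford (c : R) (k : nat) : R := (-1) ^+ k / k`!%:R / rising c k.

Lemma clifford0 c : clifford c 0 = 1.
Proof. by rewrite /clifford fact0 /rising big_ord0 expr0 !divr1. Qed.

Lemma factorially_bounded_clifford c : 1 <= c -> factorially_bounded (clifford c).
Proof.
move=> c1; exists 1 => k.
have r0 : 0 < rising c k by rewrite rising_gt0 ?(lt_le_trans ltr01).
have f0 : 0 < k`!%:R :> R by rewrite ltr0n fact_gt0.
rewrite /clifford !normrM normrX normrN1 expr1n mul1r !normfV.
rewrite !gtr0_norm// mulrAC mulVf ?gt_eqF// mul1r invf_le1//.
by apply: le_trans (rising_ge_fact k c1); rewrite ler1n fact_gt0.
Qed.

Lemma cliffordS c k : 0 < c ->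
  clifford c k.+1 = - clifford c k / (k.+1%:R * (c + k%:R)).
Proof.
move=> c0; have r0 : 0 < rising c k by rewrite rising_gt0.
have f0 : 0 < k`!%:R :> R by rewrite ltr0n fact_gt0.
have ck : 0 < c + k%:R by rewrite ltr_wpDr.
rewrite /clifford risingS factS natrM exprS; field.
by rewrite !gt_eqF// ltr0n.
Qed.

Local Notation J c := (psum (clifford c)).
Local Notation dJ c := (psum (pseries_diffs (clifford c))).
Local Notation ddJ c := (psum (pseries_diffs (pseries_diffs (clifford c)))).

(** Bessel's equation in the variable 2 sqrt x. On coefficients it reads
   (k + 1) (c + k) j_(k + 1) = - j_k. *)
Lemma clifford_ode (c : R) x : 1 <= c ->
  x * ddJ c x = - (c * dJ c x + J c x).
Proof.
move=> c1; have bJ := factorially_bounded_clifford c1.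
have bdJ := factorially_bounded_diffs bJ.
rewrite -(psumZ c x bdJ) -psumD//; last exact: factorially_boundedZ.
rewrite -mulN1r -(psumZ _ x (factorially_boundedD (factorially_boundedZ c bdJ) bJ)).
symmetry; apply: psum_shift; first exact: factorially_bounded_diffs.
  rewrite /pseries_diffs cliffordS; last lra.
  by rewrite addr0 !mul1r; field; lra.
move=> k; have kc : 0 < c + k.+1%:R by rewrite ltr_wpDr//; lra.
rewrite /pseries_diffs cliffordS; last lra.
have k2 : k.+2%:R != 0 :> R by rewrite pnatr_eq0.
by move: (k.+2%:R : R) k2 (k.+1%:R : R) kc => m m0 l cl; field; rewrite m0 gt_eqF.
Qed.

(** By Bessel's equation the energy J^2 + x J'^2, which is 1 at the origin, has
   derivative (1 - 2c) J'^2 <= 0. *)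
Lemma clifford_le1 (c x : R) : 1 <= c -> 0 <= x -> `|J c x| <= 1.
Proof.
move=> c1 x0; have bJ := factorially_bounded_clifford c1.
have bdJ := factorially_bounded_diffs bJ.
have : - (J c 0 ^+ 2 + 0 * dJ c 0 ^+ 2) <= - (J c x ^+ 2 + x * dJ c x ^+ 2).
  apply: (@derive_ge0_le _ (fun y => - (J c y ^+ 2 + y * dJ c y ^+ 2))
    (fun y => (2 * c - 1) * dJ c y ^+ 2)) => // y /andP[y0 yx].
    have Jd := psum_is_derive y bJ; have dJd := psum_is_derive y bdJ.
    apply: is_derive_eq; rewrite /GRing.scale/=.
    have := clifford_ode y c1; move: (J c y) (dJ c y) (ddJ c y) => p q r yr.
    have -> : y * (q * r + q * r) = 2 * q * (y * r) by ring.
    by rewrite yr; ring.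
  by rewrite mulr_ge0 ?sqr_ge0//; lra.
rewrite mul0r addr0 psum_at0 /clifford fact0 /rising big_ord0 expr0 !divr1.
have := mulr_ge0 x0 (sqr_ge0 (dJ c x)); rewrite ler_norml => ? ?; nra.
Qed.

(** The energy only dissipates through J'. Adding the cross term J J' transfers
   dissipation to J: for V = J^2 + x J'^2 + J J', the function x^(1/2) V is
   nonincreasing for x >= (c - 1/2)^2, while V >= J^2 / 2 for x >= 1. Hence
   J^2 = O(x^(-1/2)). *)
Lemma clifford_cvg0 (c : R) : 3 / 2 <= c -> J c x @[x --> +oo] --> (0 : R).
Proof.
move=> c32; have c1 : 1 <= c by lra.
have bJ := factorially_bounded_clifford c1.
have bdJ := factorially_bounded_diffs bJ.
pose V x := J c x ^+ 2 + x * dJ c x ^+ 2 + J c x * dJ c x.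
pose T := Num.max 1 ((c - 2^-1) ^+ 2).
have T1 : 1 <= T by rewrite le_max lexx.
pose W x := x `^ 2^-1 * - V x.
have WT x : T <= x -> W T <= W x.
  move=> Tx.
  pose dV y := 2 * J c y * dJ c y + dJ c y ^+ 2 + y * (2 * dJ c y * ddJ c y)
     + dJ c y ^+ 2 + J c y * ddJ c y.
  apply: (@derive_ge0_le _ W
    (fun y => y `^ (2^-1 - 1) * (2^-1 * - V y + y * - dV y))) => // y /andP[Ty yx].
    have y0 : 0 < y by apply: lt_le_trans Ty; apply: lt_le_trans T1.
    have Jd := psum_is_derive y bJ; have dJd := psum_is_derive y bdJ.
    apply: is_derive_powRM => //.
    apply: is_derive_eq; rewrite /GRing.scale/= /dV.
    ring.
  rewrite mulr_ge0 ?powR_ge0//.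
  have y1 : 1 <= y by apply: le_trans Ty.
  have yc : (c - 2^-1) ^+ 2 <= y by apply: le_trans Ty; rewrite le_max lexx orbT.
  have := clifford_ode y c1; rewrite /V /dV; move: (J c y) (dJ c y) (ddJ c y) => p q r yr.
  (* group the multiples of y r = x J'', which the equation eliminates *)
  have -> : 2^-1 * - (p ^+ 2 + y * q ^+ 2 + p * q) +
    y * - (2 * p * q + q ^+ 2 + y * (2 * q * r) + q ^+ 2 + p * r) =
    2^-1 * - (p ^+ 2 + y * q ^+ 2 + p * q) - 2 * p * q * y - 2 * y * q ^+ 2
    - 2 * y * q * (y * r) - p * (y * r) by ring.
  (* complete the square in J + (c - 1/2) J' *)
  rewrite yr; have -> : 2^-1 * - (p ^+ 2 + y * q ^+ 2 + p * q)
    - 2 * p * q * y - 2 * y * q ^+ 2 - 2 * y * q * - (c * q + p)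
    - p * - (c * q + p) = 2^-1 * (p + (c - 2^-1) * q) ^+ 2
    + 2^-1 * (y - (c - 2^-1) ^+ 2) * q ^+ 2 + (2 * c - 3) * y * q ^+ 2 by field.
  by rewrite !addr_ge0// mulr_ge0 ?sqr_ge0// mulr_ge0; lra.
have Jle x : T <= x -> J c x ^+ 2 <= 2 * - W T * x `^ (- 2^-1).
  move=> Tx; have x1 : 1 <= x by exact: le_trans Tx.
  have x0 : 0 < x by exact: lt_le_trans x1.
  rewrite powRN ler_pdivlMr ?powR_gt0//.
  have VJ : J c x ^+ 2 <= 2 * V x.
    rewrite /V; move: (J c x) (dJ c x) => p q.
    have := mulr_ge0 (_ : 0 <= x - 1) (sqr_ge0 q); have := sqr_ge0 (p + q).
    by rewrite subr_ge0 => + /(_ x1); nra.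
  have := ler_wpM2r (powR_ge0 x 2^-1) VJ; have := WT x Tx; rewrite {2}/W; nra.
apply/cvgr0Pnorm_lt => e e0.
have C0 : 2 * - W T * x `^ (- 2^-1) @[x --> +oo] --> (0 : R).
  rewrite -[X in _ --> X](mulr0 (2 * - W T)).
  by apply: cvgMr; apply: powR_cvgy0; rewrite oppr_lt0.
near=> x; have Tx : T <= x by [].
rewrite -(@ltr_pXn2r _ 2) ?nnegrE ?(ltW e0)// real_normK ?num_real//.
apply: le_lt_trans (Jle _ Tx) _; near: x.
move/cvgr0Pnorm_lt : C0 => /(_ (e ^+ 2)); rewrite exprn_gt0// => /(_ isT).
by apply: filterS => x; apply: le_lt_trans; exact: ler_norm.
Unshelve. all: by end_near. Qed.

End BesselClifford.

(** * Truncated Mellin transforms of entire series *)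

Section MellinPrimitive.
Context {R : realType}.
Implicit Types (u : nat -> R) (a x : R).

(** For the series U with coefficients u and u_0 = 1, these are the coefficients
   of x^(1 - a) times the integral of t^(a - 2) (1 - U t) over 0 < t < x.
   The index is shifted so that the denominator a - 1 + k, k >= 1, reads a + l
   and is visibly positive, including when a <= 1. *)
Definition mellin_coeff a u k : R :=
  if k is l.+1 then - u k / (a + l%:R) else 0.

Lemma factorially_bounded_mellin a u : 0 < a ->
  factorially_bounded u -> factorially_bounded (mellin_coeff a u).
Proof.
move=> a0 [C uC]; have C0 : 0 <= C by apply: le_trans (uC 0%N); rewrite mulr_ge0.
exists (C / a) => -[|k] /=; first by rewrite normr0 mul0r divr_ge0// ltW.
have ak : a <= a + k%:R by rewrite lerDl.
rewrite normrM normrN mulrAC normfV [X in _ / X]gtr0_norm ?(lt_le_trans a0)//.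
apply: ler_pM; [exact: mulr_ge0| |exact: uC|].
  by rewrite invr_ge0 (le_trans (ltW a0)).
by rewrite lef_pV2 ?posrE ?(lt_le_trans a0).
Qed.

Lemma psum_delta x : psum (fun k => (k == 0%N)%:R) x = 1.
Proof.
apply/cvg_lim => //; rewrite -cvg_shiftS /= (_ : (fun n => _) = cst 1).
  exact: cvg_cst.
apply/funext => n; rewrite /pseries /series/= big_nat_recl//= expr0 mulr1.
by rewrite big1 ?addr0// => k _; rewrite mul0r.
Qed.

Lemma factorially_bounded_delta : factorially_bounded (fun k => (k == 0%N)%:R : R).
Proof.
by exists 1 => -[|k]; rewrite /= ?normr1 ?normr0 ?mul0r ?mul1r// fact0.
Qed.

(** The Euler operator x d/dx + (a - 1) multiplies the k-th coefficient by
   a - 1 + k, hence cancels the denominators. *)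
Lemma mellin_ode a u x : 0 < a -> factorially_bounded u -> u 0%N = 1 ->
  x * psum (pseries_diffs (mellin_coeff a u)) x =
  1 - psum u x - (a - 1) * psum (mellin_coeff a u) x.
Proof.
move=> a0 bu u0; have bm := factorially_bounded_mellin a0 bu.
have bNu := factorially_boundedZ (-1) bu.
have bNm := factorially_boundedZ (- (a - 1)) bm.
have bd := factorially_boundedD factorially_bounded_delta bNu.
symmetry; transitivity
  (psum (fun k => (k == 0%N)%:R + -1 * u k + - (a - 1) * mellin_coeff a u k) x).
  rewrite (psumD _ bd bNm) (psumD _ factorially_bounded_delta bNu).
  by rewrite (psumZ _ _ bu) (psumZ _ _ bm) psum_delta; ring.
apply: psum_shift.
- exact: factorially_bounded_diffs.
- by rewrite /= u0 mulr1 mulr0 addr0 subrr.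
- move=> k /=; rewrite add0r /pseries_diffs /= -nat1r.
  have : 0 < a + k%:R by rewrite ltr_wpDr.
  move: (k%:R : R) => l al; field.
  by rewrite gt_eqF.
Qed.

Lemma mellin_is_derive a u x : 0 < a -> factorially_bounded u -> u 0%N = 1 ->
  0 < x ->
  is_derive x 1 (fun y => y `^ (a - 1) * psum (mellin_coeff a u) y)
    (x `^ (a - 2) * (1 - psum u x)).
Proof.
move=> a0 bu u0 x0; have bm := factorially_bounded_mellin a0 bu.
rewrite (_ : x `^ (a - 2) * _ = x `^ (a - 1 - 1) * ((a - 1) * psum (mellin_coeff a u) x
   + x * psum (pseries_diffs (mellin_coeff a u)) x)).
  exact/is_derive_powRM/psum_is_derive.
rewrite mellin_ode// [_ + (1 - _ - _)]addrC subrK; congr (_ `^ _ * _); ring.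
Qed.

(** For a > 1 the weight t^(a - 2) is not integrable at infinity, so the integral
   of t^(a - 2) (1 - U t) is driven by the constant 1 and is equivalent to
   x^(a - 1) / (a - 1). *)
Lemma mellin_cvg_gt1 a u : 1 < a -> factorially_bounded u -> u 0%N = 1 ->
  psum u x @[x --> +oo] --> (0 : R) ->
  psum (mellin_coeff a u) x @[x --> +oo] --> (a - 1)^-1.
Proof.
move=> a1 bu u0 uy; have a0 : 0 < a by lra.
have a10 : a - 1 != 0 by rewrite subr_eq0 gt_eqF.
have bm := factorially_bounded_mellin a0 bu.
apply/subr_cvg0.
pose h x := x `^ (a - 1) * psum (mellin_coeff a u) x - (a - 1)^-1 * x `^ (a - 1).
have hg : h x / x `^ (a - 1) @[x --> +oo] --> (0 : R).
  apply: (@cvg_div_of_derive_little _ _ _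
    (fun x => x `^ (a - 2) * - psum u x) (fun x => (a - 1) * x `^ (a - 2))).
  - move=> x x0; have md := mellin_is_derive a0 bu u0 x0.
    have pd := is_derive1_powR (a - 1) x0.
    apply: is_derive_eq; rewrite /GRing.scale/=.
    have -> : a - 1 - 1 = a - 2 by ring.
    by field; rewrite subr_eq0 gt_eqF.
  - move=> x x0; have -> : a - 2 = a - 1 - 1 by ring.
    exact: is_derive1_powR.
  - by apply: powR_cvgy; lra.
  - move=> e e0; have ea : 0 < e * (a - 1) by rewrite mulr_gt0//; lra.
    move/cvgr0Pnorm_le : uy => /(_ _ ea); apply: filterS => x ux.
    rewrite normrM normrN (ger0_norm (powR_ge0 _ _)) mulrC mulrA.
    by rewrite ler_wpM2r ?powR_ge0.
apply: cvg_trans hg; apply: near_eq_cvg; near=> x.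
have x0 : 0 < x by [].
have xa : x `^ (a - 1) != 0 by rewrite gt_eqF ?powR_gt0.
by rewrite /h /=; field; rewrite xa subr_eq0 gt_eqF.
Unshelve. all: by end_near. Qed.

(** In the critical case a = 1 the weight is 1 / t, hence the logarithm. *)
Lemma mellin_cvg_eq1 u : factorially_bounded u -> u 0%N = 1 ->
  psum u x @[x --> +oo] --> (0 : R) ->
  psum (mellin_coeff 1 u) x / ln x @[x --> +oo] --> (1 : R).
Proof.
move=> bu u0 uy; have bm := factorially_bounded_mellin ltr01 bu.
apply/subr_cvg0.
have hg : (psum (mellin_coeff 1 u) x - ln x) / ln x @[x --> +oo] --> (0 : R).
  apply: (@cvg_div_of_derive_little _ _ _
    (fun x => psum (pseries_diffs (mellin_coeff 1 u)) x - x^-1) (fun x => x^-1)).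
  - move=> x x0; have md := psum_is_derive x bm.
    by have ld := is_derive1_ln x0; exact: is_deriveB.
  - exact: ln_cvgy.
  - move=> e e0; move/cvgr0Pnorm_le : uy => /(_ _ e0) uy.
    near=> x; have x0 : 0 < x by [].
    have -> : psum (pseries_diffs (mellin_coeff 1 u)) x - x^-1 = - psum u x / x.
      apply: (@mulfI _ x); first by rewrite gt_eqF.
      rewrite mulrBr mellin_ode//.
      by field; rewrite gt_eqF.
    rewrite normrM normrN normfV (gtr0_norm x0) ler_wpM2r ?invr_ge0 ?(ltW x0)//.
    by near: x.
apply: cvg_trans hg; apply: near_eq_cvg; near=> x.
have x1 : 1 < x by [].
by rewrite /= mulrBl divff// gt_eqF// ln_gt0.
Unshelve. all: by end_near. Qed.

End MellinPrimitive.

(** * Lebesgue integrals over the open half-line *)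

Section HalfLineIntegral.
Context {R : realType}.
Implicit Types f F : R -> R.
Local Notation mu := (@lebesgue_measure R).
Local Notation pos := (`]0%R, +oo[%classic : set R).

(** Integrands may be singular at 0 and the domain is unbounded, so the
   half-line is exhausted by compact windows. *)
Let window m : set R := `[m.+1%:R^-1, m.+2%:R].

Let inv_lt m : (m.+1%:R^-1 : R) < m.+2%:R.
Proof. by rewrite (@le_lt_trans _ _ 1)// ?invf_le1 ?ler1n ?ltr1n. Qed.

Let inv_gt0 m : 0 < (m.+1%:R^-1 : R).
Proof. by rewrite invr_gt0 ltr0n. Qed.

Let window_gt0 m x : window m x -> 0 < x.
Proof. by rewrite /window/= in_itv/= => /andP[+ _]; apply: lt_le_trans. Qed.

Let window_nd : {homo window : n m / (n <= m)%N >-> (n <= m)%O}.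
Proof.
move=> n m nm; apply/subsetPset => x; rewrite /window/= !in_itv/= => /andP[nx xn].
apply/andP; split.
  by apply: le_trans nx; rewrite lef_pV2 ?posrE ?ltr0n// ler_nat.
by apply: le_trans xn _; rewrite ler_nat.
Qed.

Let window_near x : 0 < x -> \forall m \near \oo, window m x.
Proof.
move=> x0; near=> m; rewrite /window/= in_itv/=; apply/andP; split.
  rewrite -[leRHS]invrK lef_pV2 ?posrE ?ltr0n ?invr_gt0//.
  rewrite (@le_trans _ _ m%:R) ?ler_nat//.
  by near: m; exact: nbhs_infty_ger.
rewrite (@le_trans _ _ m%:R) ?ler_nat//.
  by near: m; exact: nbhs_infty_ger.
by rewrite -addn2 leq_addr.
Unshelve. all: by end_near. Qed.

Let bigcup_window : \bigcup_m window m = pos.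
Proof.
apply/seteqP; split => [x [m _ /window_gt0 x0]|x]; first by rewrite /= in_itv/= x0.
rewrite /= in_itv/= andbT => /window_near[m _ mx].
by exists m => //; exact: mx (leqnn m).
Qed.

Lemma measurable_fun_pos f : (forall x : R, 0 < x -> {for x, continuous f}) ->
  measurable_fun pos f.
Proof.
move=> fc; apply: open_continuous_measurable_fun => // x.
by rewrite inE/= in_itv/= andbT; exact: fc.
Qed.

Let window_integral f F m : (forall x : R, 0 < x -> {for x, continuous f}) ->
  (forall x : R, 0 < x -> is_derive x 1 F (f x)) ->
  (\int[mu]_(x in window m) (f x)%:E = (F m.+2%:R - F m.+1%:R^-1)%:E)%E.
Proof.
move=> fc Fd; have Fc x : 0 < x -> {for x, continuous F}.
  move=> x0; apply/differentiable_continuous/derivable1_diffP.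
  by have [] := Fd x x0.
rewrite EFinB; apply: continuous_FTC2 => //.
- apply/continuous_within_itvP => //; split.
  + move=> x; rewrite in_itv/= => /andP[mx _].
    exact/fc/(lt_trans (inv_gt0 m)).
  + exact/cvg_at_right_filter/fc.
  + by apply/cvg_at_left_filter/fc; rewrite ltr0n.
- split.
  + move=> x; rewrite in_itv/= => /andP[mx _].
    by have [] := Fd x (lt_trans (inv_gt0 m) mx).
  + exact/cvg_at_right_filter/Fc.
  + by apply/cvg_at_left_filter/Fc; rewrite ltr0n.
- move=> x; rewrite in_itv/= => /andP[mx _].
  have [] := Fd x (lt_trans (inv_gt0 m) mx).
  by rewrite derive1E.
Qed.

(** Monotone convergence along the windows, on which the fundamental theorem of
   calculus bounds the integral by 2 M. *)
Lemma integrable_bounded_primitive f F (M : R) :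
  (forall x : R, 0 < x -> {for x, continuous f}) ->
  (forall x : R, 0 < x -> 0 <= f x) ->
  (forall x : R, 0 < x -> is_derive x 1 F (f x)) ->
  (forall x : R, 0 < x -> `|F x| <= M) ->
  mu.-integrable pos (EFin \o f).
Proof.
move=> fc f0 Fd FM; have mf := measurable_fun_pos fc.
apply/integrableP; split; first exact/measurable_EFinP.
have -> : (\int[mu]_(x in pos) `|(EFin \o f) x|)%E =
    (\int[mu]_(x in pos) (f x)%:E)%E.
  apply: eq_integral => x; rewrite inE/= in_itv/= andbT => x0.
  by rewrite ger0_norm// f0.
have : (\int[mu]_(x in window m) (f x)%:E)%E @[m --> \oo] -->
    (\int[mu]_(x in pos) (f x)%:E)%E.
  rewrite -bigcup_window; apply: ge0_nondecreasing_set_cvg_integral => //.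
  - by move=> m; apply: measurable_itv.
  - move=> m; apply/measurable_EFinP; apply: measurable_funS mf => // x.
    by move=> /window_gt0 x0; rewrite /= in_itv/= x0.
  - by move=> m x /window_gt0 x0; rewrite lee_fin f0.
move=> wf; rewrite -(cvg_lim _ wf)//.
apply: (@le_lt_trans _ _ (2 * M)%:E); last exact: ltry.
apply: lime_le; first by apply/cvg_ex; eexists; exact: wf.
apply: nearW => m; rewrite (window_integral _ fc Fd) lee_fin.
have := FM _ (inv_gt0 m); have := FM m.+2%:R (ltr0Sn _ _).
by rewrite !ler_norml => /andP[? ?] /andP[? ?]; lra.
Qed.

(** The same exhaustion for integrands of arbitrary sign, now by dominated
   convergence. *)
Lemma Rintegral_primitive f F (l0 l1 : R) :
  (forall x : R, 0 < x -> {for x, continuous f}) ->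
  mu.-integrable pos (EFin \o f) ->
  (forall x : R, 0 < x -> is_derive x 1 F (f x)) ->
  F x @[x --> 0^'+] --> l0 -> F x @[x --> +oo] --> l1 ->
  \int[mu]_(x in pos) f x = l1 - l0.
Proof.
move=> fc intf Fd F0 Fy; have mf := measurable_fun_pos fc.
have h1 : (\int[mu]_(x in window m) (f x)%:E)%E @[m --> \oo] -->
    (\int[mu]_(x in pos) (f x)%:E)%E.
  have wE m : (\int[mu]_(x in window m) (f x)%:E)%E =
      (\int[mu]_(x in pos) ((EFin \o f) \_ (window m)) x)%E.
    rewrite -integral_mkcondr; congr (integral _ _ _).
    by rewrite setIidr// => x /window_gt0 x0; rewrite /= in_itv/= x0.
  under eq_fun do rewrite wE.
  apply: (@dominated_cvg _ _ _ mu pos (measurable_itv _)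
    (fun m => (EFin \o f) \_ (window m)) (EFin \o f) (abse \o (EFin \o f))) => //.
  - move=> m; apply/measurable_restrict => //; first exact: measurable_itv.
    by apply/measurable_EFinP; apply: measurable_funS mf.
  - move=> x; rewrite /= in_itv/= andbT => /window_near xw.
    apply: cvg_near_cst; apply: filterS xw => m xm.
    by rewrite patchE mem_set.
  - by apply: integrable_abse intf.
  - move=> m x _; rewrite patchE; case: ifPn => // _.
    by rewrite (_ : point = 0%E)// abse0 abse_ge0.
have h2 : (\int[mu]_(x in window m) (f x)%:E)%E @[m --> \oo] --> (l1 - l0)%:E.
  under eq_fun do rewrite (window_integral _ fc Fd).
  apply: cvg_EFin; first exact: nearW.
  apply: cvgB.
    move/cvg_pinftyP : Fy; apply; apply/cvgryPge => M; near=> m.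
    rewrite (@le_trans _ _ m%:R) ?ler_nat//; last by rewrite -addn2 leq_addr.
    by near: m; exact: nbhs_infty_ger.
  move/cvg_at_rightP : F0; apply; split => //.
  exact: cvg_harmonic.
by rewrite /Rintegral (cvg_unique _ h1 h2).
Unshelve. all: by end_near. Qed.

End HalfLineIntegral.

(** * Euler's integral *)

Section GammaFunction.
Context {R : realType}.
Local Notation mu := (@lebesgue_measure R).
Local Notation pos := (`]0%R, +oo[%classic : set R).
Implicit Types (a c x y p t theta : R).

(** The rate theta = 1/2 serves to dominate integrands that grow like e^(s / 2)
   relative to the density of rate 1. *)
Definition gamma_density (x theta t : R) : R := t `^ (x - 1) * expR (- (theta * t)).

Lemma gamma_density_ge0 x theta t : 0 <= gamma_density x theta t.
Proof. by rewrite mulr_ge0 ?powR_ge0 ?expR_ge0. Qed.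

Lemma is_derive_powR_expRN (p theta t : R) : 0 < t ->
  is_derive t 1 (fun t => t `^ p * expR (- (theta * t)))
    (t `^ (p - 1) * (p * expR (- (theta * t)) - t * theta * expR (- (theta * t)))).
Proof.
move=> t0.
have ed : is_derive t 1 (fun t => expR (- (theta * t))) (- theta * expR (- (theta * t))).
  apply: is_derive_eq; rewrite /GRing.scale/=; ring.
have -> : p * expR (- (theta * t)) - t * theta * expR (- (theta * t)) =
  p * expR (- (theta * t)) + t * (- theta * expR (- (theta * t))) by ring.
exact: is_derive_powRM.
Qed.

Lemma continuous_gamma_density x theta t : 0 < t ->
  {for t, continuous (gamma_density x theta)}.
Proof. by move=> t0; apply: is_derive_continuous (is_derive_powR_expRN _ _ t0). Qed.

(** Near 0 the density behaves like t^(x - 1) and near infinity it is smaller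
   than any power. The derivative of the bounded function (t / (1 + t))^x is
   comparable to t^(x - 1) near 0 and to t^(-2) near infinity, so it
   dominates both ends at once. *)
Lemma integrable_gamma_density x theta : 0 < x -> 0 < theta ->
  mu.-integrable pos (EFin \o gamma_density x theta).
Proof.
move=> x0 th0; have [C HC] := powR_expRN_bounded (x + 1) th0.
have C0 : 0 <= C.
  by apply: le_trans (HC 0 (lexx 0)); rewrite mulr_ge0 ?powR_ge0 ?expR_ge0.
pose w (t : R) := t * (1 + t)^-1.
pose dG (t : R) := x * w t `^ (x - 1) * (1 + t)^-1 ^+ 2.
have w0 t : 0 < t -> 0 < w t.
  by move=> t0; rewrite mulr_gt0// invr_gt0 ltr_wpDr// ltW.
have dV (t : R) : 0 < t -> is_derive t 1 (fun t : R => (1 + t)^-1)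
    (- (1 + t) ^- 2 *: (1 : R)).
  move=> t0; have t1 : 1 + t != 0 by rewrite gt_eqF// ltr_wpDr// ltW.
  have d1 : is_derive t 1 (cst 1 + id : R -> R) 1.
    by apply: is_derive_eq; rewrite add0r.
  exact: (is_deriveV t1 d1).
have wd (t : R) : 0 < t -> is_derive t 1 w ((1 + t)^-1 ^+ 2).
  move=> t0; have t1 : 1 + t != 0 by rewrite gt_eqF// ltr_wpDr// ltW.
  have dVt := dV t t0.
  apply: is_derive_eq; rewrite /GRing.scale/=.
  by field.
have Gd (t : R) : 0 < t -> is_derive t 1 ((fun y : R => y `^ x) \o w) (dG t).
  move=> t0; have px := is_derive1_powR x (w0 _ t0).
  exact: (@is_derive1_comp _ _ w t _ _ px (wd t t0)).
have dGc (t : R) : 0 < t -> {for t, continuous dG}.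
  move=> t0; have px := is_derive1_powR (x - 1) (w0 _ t0).
  have c1 := is_derive_continuous (@is_derive1_comp _ _ w t _ _ px (wd t t0)).
  have c2 := is_derive_continuous (dV t t0).
  apply: continuousM; [apply: continuousM|].
  - exact: cst_continuous.
  - exact: c1.
  - exact: (continuousM c2 c2).
have intG : mu.-integrable pos (EFin \o dG).
  apply: (@integrable_bounded_primitive _ dG ((fun y : R => y `^ x) \o w) 1) => // t t0.
    by rewrite /dG mulr_ge0 ?sqr_ge0// mulr_ge0 ?powR_ge0// ltW.
  rewrite ger0_norm ?powR_ge0//= -[leRHS](congr1 (fun f => f x) (powR1 R)).
  apply: ge0_ler_powR; rewrite ?nnegrE ?(ltW x0) ?(ltW (w0 _ _))//.
  by rewrite ler_pdivrMr ?mul1r ?lerDr// ltr_wpDr// ltW.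
apply: (@le_integrable _ _ _ mu pos (measurable_itv _) _
  (fun t => (C / x)%:E * (EFin \o dG) t)%E).
- apply/measurable_EFinP; apply: measurable_fun_pos => t.
  exact: continuous_gamma_density.
- move=> t; rewrite /= in_itv/= andbT => t0.
  have t1 : 0 < 1 + t by rewrite ltr_wpDr// ltW.
  rewrite lee_fin ger0_norm ?gamma_density_ge0//.
  apply: le_trans (ler_norm _).
  have -> : C / x * dG t = C * (t `^ (x - 1) * (1 + t) `^ (- (x + 1))).
    rewrite /dG /w powRM ?invr_ge0 ?ltW//.
    have -> : (1 + t)^-1 `^ (x - 1) = (1 + t) `^ (- (x - 1)).
      by rewrite -powR_inv1 ?ltW// -powRrM mulN1r.
    have -> : (1 + t)^-1 ^+ 2 = (1 + t) `^ (- 2).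
      by rewrite powRN -[2 in RHS]/(2%:R) powR_mulrn ?exprVn// ltW.
    rewrite (@powRDgt0 _ (- (x + 1)) (- (x - 1)) (- 2))//; last by ring.
    by field; rewrite gt_eqF.
  rewrite /gamma_density mulrCA ler_wpM2l ?powR_ge0//.
  rewrite powRN ler_pdivlMr ?powR_gt0// mulrC.
  exact/HC/ltW.
- by apply: integrableZl.
Qed.

Lemma gamma_density1 x t : gamma_density x 1 t = t `^ (x - 1) * expR (- t).
Proof. by rewrite /gamma_density mul1r. Qed.

Lemma GammaE x : Gamma x = \int[mu]_(t in pos) gamma_density x 1 t.
Proof. by rewrite /Gamma; apply: eq_Rintegral => t _; rewrite gamma_density1. Qed.

Lemma powR_expRN_cvgy x : 0 <= x -> t `^ x * expR (- t) @[t --> +oo] --> (0 : R).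
Proof.
move=> x0; have [C HC] := powR_expRN_bounded (x + 1) ltr01.
have Ct : C * t `^ (-1) @[t --> +oo] --> (0 : R).
  rewrite -[X in _ --> X](mulr0 C).
  by apply: cvgMr; apply: powR_cvgy0; rewrite oppr_lt0.
apply: (@squeeze_cvgr _ _ _ _ (cst 0) (fun t => C * t `^ (-1)));
  [|exact: cvg_cst|exact: Ct].
near=> t; have t0 : 0 < t by [].
have t1 : 0 < 1 + t by rewrite ltr_wpDr// ltW.
rewrite mulr_ge0 ?powR_ge0 ?expR_ge0//= powR_inv1 ?(ltW t0)// ler_pdivlMr//.
apply: le_trans (HC t (ltW t0)); rewrite mul1r mulrAC ler_wpM2r ?expR_ge0//.
rewrite -(@mulr_powRB1 _ (1 + t) (x + 1)) ?(ltW t1) ?ltr_wpDl//.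
rewrite addrK mulrC; apply: ler_pM; rewrite ?powR_ge0 ?(ltW t0)//.
  by rewrite lerDr.
by apply: ge0_ler_powR; rewrite ?nnegrE ?(ltW t0) ?(ltW t1)// lerDr.
Unshelve. all: by end_near. Qed.

(** Integration by parts: t^x e^-t is a primitive of the difference of the two
   integrands and vanishes at both ends. *)
Lemma Gamma_functional x : 0 < x -> Gamma (x + 1) = x * Gamma x.
Proof.
move=> x0; have x1 : 0 < x + 1 by rewrite ltr_wpDl// ltW.
have ix := integrable_gamma_density x0 ltr01.
have ix1 := integrable_gamma_density x1 ltr01.
have ixx : mu.-integrable pos (EFin \o (fun t => x * gamma_density x 1 t)).
  by have := @integrableZl _ _ _ mu pos (measurable_itv _) x _ ix.
apply/eqP; rewrite eq_sym -subr_eq0 !GammaE -RintegralZl// -RintegralB//.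
apply/eqP; rewrite -[RHS](subrr 0).
apply: (@Rintegral_primitive _ _ (fun t => t `^ x * expR (- (1 * t)))).
- move=> t t0; apply: continuousB; last exact: continuous_gamma_density.
  by apply: continuousM; [exact: cst_continuous|exact: continuous_gamma_density].
- by have := @integrableB _ _ _ mu pos (measurable_itv _) _ _ ixx ix1.
- move=> t t0; have := is_derive_powR_expRN x 1 t0.
  rewrite /gamma_density addrK -(@mulr_powRB1 _ t x) ?(ltW t0)//.
  by congr is_derive; ring.
- have c0 : t `^ x * expR (- t) @[t --> 0^'+] --> 0 * expR (- 0 : R).
    apply: cvgM; first exact: powR_cvg0.
    apply: cvg_at_right_filter.
    by apply: (@cvg_comp _ _ _ -%R expR); [exact: opp_continuous|exact: continuous_expR].
  by under eq_fun do rewrite mul1r; rewrite mul0r in c0; exact: c0.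
- under eq_fun do rewrite mul1r.
  exact/powR_expRN_cvgy/ltW.
Qed.

(** The integrand is at least m > 0 on [1, 2], because ln t <= t there. *)
Lemma Gamma_gt0 x : 0 < x -> 0 < Gamma x.
Proof.
move=> x0; have ix := integrable_gamma_density x0 ltr01.
pose m := expR (- ((`|x - 1| + 1) * 2)).
have ml t : t \in (`[1, 2] : interval R) -> m <= gamma_density x 1 t.
  rewrite in_itv/= => /andP[t1 t2]; have t0 : 0 < t by lra.
  rewrite gamma_density1 /powR gt_eqF// -expRD ler_expR.
  have lt0 := ln_ge0 t1; have ltt := ltW (ln_sublinear t0).
  have := ler_norm (- (x - 1)); rewrite normrN; have := normr_ge0 (x - 1).
  move: (`|x - 1|) (x - 1) (ln t) lt0 ltt => n y l l0 lt n0 yn.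
  nra.
apply: (@lt_le_trans _ _ m); first exact: expR_gt0.
have sub : `[1, 2] `<=` pos.
  by move=> t; rewrite /= !in_itv/= andbT => /andP[t1 _]; lra.
rewrite GammaE -lee_fin /Rintegral fineK; last first.
  exact: (integrable_fin_num _ ix).
apply: (@le_trans _ _ (\int[mu]_(t in `[1%R, 2%R]) (m%:E))%E).
  rewrite integral_cst//= lebesgue_measure_itv/= lte_fin ltr1n/= -EFinD.
  by rewrite -EFinM lee_fin; lra.
apply: (@le_trans _ _ (\int[mu]_(t in `[1%R, 2%R]) (gamma_density x 1 t)%:E)%E).
  apply: ge0_le_integral => //.
  - by move=> t _; rewrite lee_fin expR_ge0.
  - by apply: measurable_funS (measurable_int _ ix).
apply: ge0_subset_integral => //.
- exact: (measurable_int _ ix).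
- by move=> t _; rewrite lee_fin gamma_density_ge0.
Qed.

Lemma Gamma_rising x k : 0 < x -> Gamma (x + k%:R) = rising x k * Gamma x.
Proof.
move=> x0; elim: k => [|k IH]; first by rewrite addr0 /rising big_ord0 mul1r.
have xk : 0 < x + k%:R by rewrite ltr_wpDr.
rewrite -natr1 addrA (Gamma_functional xk) IH risingS.
by move: (Gamma x) (rising x k) => g r; ring.
Qed.

Lemma rGamma_gt0 x : 0 < x -> rGamma x = (Gamma x)^-1.
Proof.
move=> x0; rewrite /rGamma Gamma_rising//.
have r0 := rising_gt0 (Num.truncn `|x|).+1 x0.
by rewrite invfM mulrA divff ?mul1r// gt_eqF.
Qed.

End GammaFunction.

(** * Averaging entire series against the Gamma density *)

Section LaplaceTransform.
Context {R : realType}.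
Local Notation mu := (@lebesgue_measure R).
Local Notation pos := (`]0%R, +oo[%classic : set R).
Implicit Types (u : nat -> R) (a c q : R).

Let mpos : measurable pos. Proof. exact: measurable_itv. Qed.

Lemma dominated_cvg_pos (f_ : nat -> R -> R) (f g : R -> R) :
  (forall n, mu.-integrable pos (EFin \o f_ n)) ->
  (forall s, 0 < s -> f_ n s @[n --> \oo] --> f s) ->
  mu.-integrable pos (EFin \o g) ->
  (forall n s, 0 < s -> `|f_ n s| <= g s) ->
  \int[mu]_(s in pos) f_ n s @[n --> \oo] --> \int[mu]_(s in pos) f s.
Proof.
move=> intf ff intg fg.
have posE s : pos s -> 0 < s by rewrite /= in_itv/= andbT.
have mf_ n : measurable_fun pos (EFin \o f_ n) by exact: measurable_int (intf n).
have ef s : pos s -> (EFin \o f_ n) s @[n --> \oo] --> (EFin \o f) s.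
  by move=> /posE s0; apply: cvg_EFin; [exact: nearW|exact: ff].
have mf := emeasurable_fun_cvg _ _ mf_ ef.
have aef : {ae mu, forall s, pos s ->
    (EFin \o f_ n) s @[n --> \oo] --> (EFin \o f) s} by exact: aeW.
have aeg : {ae mu, forall s, forall n, pos s ->
    (`|(EFin \o f_ n) s| <= (EFin \o g) s)%E}.
  by apply: aeW => s n /posE s0; rewrite lee_fin fg.
have [] := @dominated_convergence _ _ _ mu pos mpos _ _ _ mf_ mf aef intg aeg.
move=> intF _ cvgF; apply: fine_cvg.
by rewrite fineK//; exact: integrable_fin_num intF.
Qed.

Lemma gamma_densityD c k (s : R) : 0 < s ->
  gamma_density (c + k%:R) 1 s = s ^+ k * gamma_density c 1 s.
Proof.
move=> s0; rewrite /gamma_density.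
rewrite (@powRDgt0 _ (c + k%:R - 1) k%:R (c - 1))//; last by ring.
by rewrite powR_mulrn ?(ltW s0)// mulrA.
Qed.

Let partial u c q n (s : R) :=
  \sum_(0 <= k < n) u k * q ^+ k * gamma_density (c + k%:R) 1 s.

Let partialS u c q n : partial u c q n.+1 =
  (fun s => partial u c q n s + u n * q ^+ n * gamma_density (c + n%:R) 1 s).
Proof. by apply/funext => s; rewrite /partial big_nat_recr. Qed.

Let term_integrable u c q n : 0 < c ->
  mu.-integrable pos (EFin \o (fun s => u n * q ^+ n * gamma_density (c + n%:R) 1 s)).
Proof.
move=> c0; have cn : 0 < c + n%:R by rewrite ltr_wpDr.
by have := @integrableZl _ _ _ mu pos mpos (u n * q ^+ n) _
  (integrable_gamma_density cn ltr01).
Qed.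

Let partial_integrable u c q n : 0 < c ->
  mu.-integrable pos (EFin \o partial u c q n).
Proof.
move=> c0; elim: n => [|n IH].
  rewrite (_ : EFin \o _ = cst 0%E); first exact: integrable0.
  by apply/funext => s; rewrite /partial /= big_geq.
rewrite partialS.
by have := @integrableD _ _ _ mu pos mpos _ _ IH (term_integrable u q n c0).
Qed.

Let partial_integral u c q n : 0 < c ->
  \int[mu]_(s in pos) partial u c q n s =
  Gamma c * \sum_(0 <= k < n) rising c k * u k * q ^+ k.
Proof.
move=> c0; elim: n => [|n IH].
  rewrite big_geq// mulr0 /Rintegral integral0_eq// => s _.
  by rewrite /partial big_geq.
have cn : 0 < c + n%:R by rewrite ltr_wpDr.
rewrite partialS RintegralD//; last 2 first.
  exact: partial_integrable.
  exact: term_integrable.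
rewrite IH RintegralZl//; last exact: integrable_gamma_density.
by rewrite -GammaE Gamma_rising// big_nat_recr//= mulrDr; congr (_ + _); ring.
Qed.

(** Integrating s^k against the density produces Gamma(c + k) = (c)_k Gamma(c), so
   averaging multiplies the k-th coefficient by (c)_k. Termwise integration is
   legitimate for every q, not just for small q, since (c)_k >= k!: the
   coefficients are O(1 / k!^2), and (s q)^k / k!^2 is the product of the k-th
   terms of e^(s / 2) and e^(2 q), so that e^(2 q) e^(s / 2) dominates all
   partial sums. *)
Lemma laplace_psum u c q C : 1 <= c -> 0 <= q ->
  (forall k, `|u k| * k`!%:R * rising c k <= C) ->
  \int[mu]_(s in pos) (gamma_density c 1 s * psum u (s * q)) =
  Gamma c * psum (fun k => rising c k * u k) q.
Proof.
move=> c1 q0 uC; have c0 : 0 < c by lra.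
have r0 k : 0 < rising c k by exact: rising_gt0.
have f0 k : 0 < k`!%:R :> R by rewrite ltr0n fact_gt0.
have C0 : 0 <= C.
  by apply: le_trans (uC 0%N); rewrite !mulr_ge0// ltW.
have uC2 k : `|u k| <= C / (k`!%:R * k`!%:R).
  rewrite ler_pdivlMr ?mulr_gt0// mulrA; apply: le_trans (uC k).
  by rewrite ler_wpM2l ?mulr_ge0// rising_ge_fact.
have bu : factorially_bounded u.
  exists C => k; apply: le_trans (uC k); rewrite ler_peMr ?mulr_ge0//.
  by apply: le_trans (rising_ge_fact k c1); rewrite ler1n fact_gt0.
have bru : factorially_bounded (fun k => rising c k * u k).
  exists C => k; apply: le_trans (uC k).
  rewrite normrM (gtr0_norm (r0 k)) [leLHS](_ : _ = `|u k| * k`!%:R * rising c k)//.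
  ring.
pose g s : R := C * expR (2 * q) * gamma_density c 2^-1 s.
have ig : mu.-integrable pos (EFin \o g).
  have h : 0 < 2^-1 :> R by rewrite invr_gt0.
  by have := @integrableZl _ _ _ mu pos mpos (C * expR (2 * q)) _
    (integrable_gamma_density c0 h).
have lim1 : \int[mu]_(s in pos) partial u c q n s @[n --> \oo] -->
    \int[mu]_(s in pos) (gamma_density c 1 s * psum u (s * q)).
  apply: (dominated_cvg_pos _ _ ig) => [n|s s0|n s s0].
  - exact: partial_integrable.
  - rewrite (_ : (fun n => _) = (fun n => gamma_density c 1 s * pseries u (s * q) n)).
      by apply: cvgMr; exact: factorially_bounded_cvg.
    apply/funext => n; rewrite /partial /= /pseries /series /= mulr_sumr.
    by apply: eq_bigr => k _; rewrite gamma_densityD// exprMn; ring.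
  - apply: le_trans (ler_norm_sum _ _ _) _.
    apply: (@le_trans _ _ (\sum_(0 <= k < n) C * expR (2 * q) * gamma_density c 1 s *
        ((2^-1 * s) ^+ k / k`!%:R))).
      apply: ler_sum => k _.
      rewrite gamma_densityD// !normrM !normrX (ger0_norm q0) (gtr0_norm s0).
      rewrite (ger0_norm (powR_ge0 _ _)) (ger0_norm (expR_ge0 _)).
      rewrite -/(gamma_density c 1 s).
      have e2q : (2 * q) ^+ k <= expR (2 * q) * k`!%:R.
        by rewrite -ler_pdivrMr// expR_ge_exp_coeff// mulr_ge0.
      have two_k : 2 ^+ k * 2^-1 ^+ k = 1 :> R.
        by rewrite -exprMn divff ?expr1n// pnatr_eq0.
      have -> : `|u k| * q ^+ k * (s ^+ k * gamma_density c 1 s) =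
          `|u k| * (2 * q) ^+ k * ((2^-1 * s) ^+ k * gamma_density c 1 s).
        rewrite !exprMn; move: (2 ^+ k : R) (2^-1 ^+ k : R) two_k => A B AB.
        move: (gamma_density c 1 s) (s ^+ k) (q ^+ k) (`|u k|) => G S Q U.
        rewrite [RHS](_ : _ = A * B * (U * Q * (S * G))); last by ring.
        by rewrite AB mul1r.
      have -> : C * expR (2 * q) * gamma_density c 1 s * ((2^-1 * s) ^+ k / k`!%:R) =
          C / (k`!%:R * k`!%:R) * (expR (2 * q) * k`!%:R) *
          ((2^-1 * s) ^+ k * gamma_density c 1 s).
        by field; rewrite gt_eqF.
      apply: ler_wpM2r; last by rewrite ler_pM// exprn_ge0// mulr_ge0.
      by rewrite mulr_ge0 ?gamma_density_ge0// exprn_ge0// mulr_ge0 ?invr_ge0// ltW.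
    rewrite -mulr_sumr /g /gamma_density -[leLHS]mulrA.
    rewrite ler_wpM2l ?mulr_ge0 ?expR_ge0// -mulrA ler_wpM2l ?powR_ge0//.
    have -> : expR (- (2^-1 * s)) = expR (- (1 * s)) * expR (2^-1 * s).
      by rewrite -expRD; congr expR; field.
    rewrite ler_wpM2l ?expR_ge0// expR_ge_partial_sum// mulr_ge0 ?invr_ge0//.
    exact: ltW.
have lim2 : \int[mu]_(s in pos) partial u c q n s @[n --> \oo] -->
    Gamma c * psum (fun k => rising c k * u k) q.
  under eq_fun do rewrite partial_integral//.
  by apply: cvgMr; exact: factorially_bounded_cvg.
exact: (cvg_unique _ lim1 lim2).
Qed.

End LaplaceTransform.

(** * The Mellin transform of the Bessel-Clifford function *)

Section MellinLimit.
Context {R : realType}.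
Local Notation mu := (@lebesgue_measure R).
Local Notation pos := (`]0%R, +oo[%classic : set R).
Implicit Types (u : nat -> R) (a c x y : R).

(** With U the sum of the series u, u_0 = 1, this is the integral of
   t^(a - 2) (1 - U t) over 0 < t < x: see mellin_is_derive for the derivative
   and mellin_cvg_at0 for the value at 0. *)
Definition mellin a u x : R := x `^ (a - 1) * psum (mellin_coeff a u) x.

Lemma mellin_cvg_at0 a u : 0 < a -> factorially_bounded u ->
  mellin a u x @[x --> 0^'+] --> (0 : R).
Proof.
move=> a0 bu; have bm := factorially_bounded_mellin a0 bu.
pose v k := mellin_coeff a u k.+1.
have bv : factorially_bounded v := factorially_bounded_shift bm.
have c0 : x `^ a * psum v x @[x --> 0^'+] --> 0 * psum v 0.
  apply: cvgM; first exact: powR_cvg0.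
  exact/cvg_at_right_filter/psum_continuous.
rewrite mul0r in c0; apply: cvg_trans c0; apply: near_eq_cvg; near=> x.
have x0 : 0 < x by [].
rewrite /mellin (@psum_shift _ v (mellin_coeff a u) x bv)// mulrA; congr (_ * _).
by rewrite mulrC mulr_powRB1// ltW.
Unshelve. all: by end_near. Qed.

Lemma mellin_nondecreasing a u x y : 0 < a -> factorially_bounded u -> u 0%N = 1 ->
  (forall t : R, 0 <= t -> `|psum u t| <= 1) ->
  0 < x -> x <= y -> mellin a u x <= mellin a u y.
Proof.
move=> a0 bu u0 u_le1 x0 xy; apply: (@derive_ge0_le _ (mellin a u)
  (fun x => x `^ (a - 2) * (1 - psum u x))) => // t /andP[xt _].
  exact/mellin_is_derive/(lt_le_trans x0).
have t0 : 0 <= t by exact: le_trans (ltW x0) xt.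
rewrite mulr_ge0 ?powR_ge0// subr_ge0.
exact: le_trans (ler_norm _) (u_le1 t t0).
Qed.

Lemma mellin_le a u x : 0 < a -> a < 1 -> factorially_bounded u -> u 0%N = 1 ->
  (forall t : R, 0 <= t -> `|psum u t| <= 1) ->
  0 < x -> mellin a u x <= mellin a u 1 + 2 / (1 - a).
Proof.
move=> a0 a1 bu u0 u_le1 x0; have a1' : 0 < 1 - a by lra.
have [x1|/ltW x1] := leP x 1.
  apply: le_trans (mellin_nondecreasing a0 bu u0 u_le1 x0 x1) _.
  by rewrite lerDl divr_ge0// ltW.
have : `|mellin a u x - mellin a u 1| <=
    2 / (a - 1) * x `^ (a - 1) - 2 / (a - 1) * 1 `^ (a - 1).
  apply: (@derive_norm_le _ (mellin a u)
    (fun x => x `^ (a - 2) * (1 - psum u x))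
    (fun t => 2 / (a - 1) * t `^ (a - 1)) (fun t => 2 * t `^ (a - 2))
    1 x x1) => t /andP[t1 _]; have t0 : 0 < t by lra.
  - exact: mellin_is_derive.
  - have pd := is_derive1_powR (a - 1) t0.
    apply: is_derive_eq; rewrite /GRing.scale/=.
    have -> : a - 1 - 1 = a - 2 by ring.
    by field; lra.
  - rewrite normrM (ger0_norm (powR_ge0 _ _)) mulrC ler_wpM2r ?powR_ge0//.
    have := u_le1 t (ltW t0); have := ler_normB 1 (psum u t); rewrite normr1; lra.
rewrite powR1 mulr1 => h.
have xa := powR_ge0 x (a - 1).
have h2 : 2 / (a - 1) * x `^ (a - 1) <= 0.
  by rewrite mulr_le0_ge0// mulr_ge0_le0// invr_le0; lra.
have h3 : 2 / (a - 1) = - (2 / (1 - a)) by field; lra.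
have := ler_norm (mellin a u x - mellin a u 1); lra.
Qed.

(** For a < 1 the integrand t^(a - 2) (1 - U t) is nonnegative, and at most
   2 t^(a - 2) away from 0, so its integral increases to a finite limit. *)
Lemma mellin_is_cvgy a u : 0 < a -> a < 1 -> factorially_bounded u -> u 0%N = 1 ->
  (forall t : R, 0 <= t -> `|psum u t| <= 1) ->
  exists2 K : R, mellin a u x @[x --> +oo] --> K &
  forall x, 0 < x -> 0 <= mellin a u x <= K.
Proof.
move=> a0 a1 bu u0 u_le1; pose f x := mellin a u (Num.max x 1).
have m1 x : 0 < Num.max x 1 by rewrite lt_max ltr01 orbT.
have fnd : nondecreasing_fun f.
  move=> x y xy; apply: mellin_nondecreasing => //.
  by rewrite ge_max !le_max xy lexx orbT.
have fub : has_ubound (range f).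
  by exists (mellin a u 1 + 2 / (1 - a)) => _ [x _ <-]; exact: mellin_le.
have fK := nondecreasing_cvgr fnd fub.
exists (sup (range f)).
  apply: cvg_trans fK; apply: near_eq_cvg; near=> x.
  by rewrite /f (max_idPl _).
move=> x x0; apply/andP; split.
  have m0 := mellin_cvg_at0 a0 bu.
  rewrite -(cvg_lim _ m0)//; apply: limr_le; first by apply/cvg_ex; exists 0.
  near=> t; apply: mellin_nondecreasing => //.
  by near: t; exact: nbhs_right_le.
apply: (@le_trans _ _ (f x)).
  by apply: mellin_nondecreasing => //; rewrite le_max lexx.
by apply: sup_upper_bound; [split; [exists (f 0), 0|] | exists x].
Unshelve. all: by end_near. Qed.

Definition exp_coeffN (k : nat) : R := (-1) ^+ k / k`!%:R.

Lemma factorially_bounded_expN : factorially_bounded exp_coeffN.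
Proof.
exists 1 => k; rewrite normrM normrX normrN1 expr1n mul1r normfV normr_nat.
by rewrite mulVf// pnatr_eq0 -lt0n fact_gt0.
Qed.

Lemma psum_expN x : psum exp_coeffN x = expR (- x).
Proof.
congr (limn (series _)); apply/funext => k.
by rewrite /exp_coeff /exp_coeffN /= -[- x]mulN1r exprMn mulrAC.
Qed.

Lemma expRN_norm_le1 x : 0 <= x -> `|expR (- x)| <= 1.
Proof. by move=> x0; rewrite ger0_norm ?expR_ge0// expR_le1 oppr_le0. Qed.

(** The integral of t^(a - 2) (1 - e^-t) is computed by parts: multiplied by
   1 - a and corrected by the boundary term x^(a - 1) (1 - e^-x), the
   truncated transform becomes a primitive of t^(a - 1) e^-t. *)
Lemma mellin_expN_cvgy a : 0 < a -> a < 1 ->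
  mellin a exp_coeffN x @[x --> +oo] --> Gamma a / (1 - a).
Proof.
move=> a0 a1; have bE := factorially_bounded_expN.
have E0 : exp_coeffN 0 = 1 by rewrite /exp_coeffN expr0 fact0 divr1.
have E1 x : 0 <= x -> `|psum exp_coeffN x| <= 1.
  by move=> x0; rewrite psum_expN expRN_norm_le1.
have [K Ky _] := mellin_is_cvgy a0 a1 bE E0 E1.
pose Q x := (1 - a) * mellin a exp_coeffN x + x `^ (a - 1) * (1 - expR (- x)).
have Qd (x : R) : 0 < x -> is_derive x 1 Q (gamma_density a 1 x).
  move=> x0; have md := mellin_is_derive a0 bE E0 x0.
  have ed : is_derive x 1 (fun x : R => 1 - expR (- x)) (expR (- x)).
    by apply: is_derive_eq; rewrite /GRing.scale/=; ring.
  have pd := is_derive_powRM (a - 1) x0 ed.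
  rewrite /Q; apply: is_derive_eq; rewrite /GRing.scale/=.
  rewrite psum_expN gamma_density1 (@powRDgt0 _ (a - 1) (a - 2) 1 x)//; last by ring.
  have -> : a - 1 - 1 = a - 2 by ring.
  by rewrite powRr1 ?ltW//; ring.
have Q0 : Q x @[x --> 0^'+] --> (1 - a) * 0 + 0.
  apply: cvgD; first by apply: cvgMr; exact: mellin_cvg_at0.
  apply: (@squeeze_cvgr _ _ _ _ (cst 0) (fun x : R => x `^ a));
    [|exact: cvg_cst|exact: powR_cvg0].
  near=> x; have x0 : 0 < x by [].
  rewrite mulr_ge0 ?powR_ge0 ?subr_ge0 ?expR_le1 ?oppr_le0 ?(ltW x0)//=.
  rewrite -(mulr_powRB1 (ltW x0) a0) mulrC ler_wpM2r ?powR_ge0//.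
  have := expR_ge1Dx (- x); lra.
have Qy : Q x @[x --> +oo] --> (1 - a) * K + 0.
  apply: cvgD; first exact: cvgMr.
  apply: (@squeeze_cvgr _ _ _ _ (cst 0) (fun x : R => x `^ (a - 1)));
    [|exact: cvg_cst|by apply: powR_cvgy0; lra].
  near=> x; have x0 : 0 < x by [].
  rewrite mulr_ge0 ?powR_ge0 ?subr_ge0 ?expR_le1 ?oppr_le0 ?(ltW x0)//=.
  rewrite ler_piMr ?powR_ge0//; have := expR_ge0 (- x); lra.
have := Rintegral_primitive (@continuous_gamma_density R a 1)
  (integrable_gamma_density a0 ltr01) Qd Q0 Qy.
rewrite -GammaE mulr0 !addr0 subr0 => ->.
by rewrite mulrAC divff ?mul1r//; lra.
Unshelve. all: by end_near. Qed.

(** Evaluation of the Mellin transform of the Bessel-Clifford function J by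
   reduction to that of e^-x. Averaging x |-> J(q x) against the Gamma density of
   parameter c turns the coefficient 1 / (k! (c)_k) into 1 / k!, hence J(q x)
   into e^-q, and it commutes with the factors 1 / (a - 1 + k). So the average
   of the transform M_J(s q) against the density of parameter c + 1 - a is
   Gamma(c) M_exp(q). As q grows the left side tends to K Gamma(c + 1 - a),
   where K is the limit of M_J, known to exist; the right side is known. *)
Lemma mellin_clifford_cvgy a c : 0 < a -> a < 1 -> 1 <= c ->
  mellin a (clifford c) x @[x --> +oo] -->
  Gamma c * (Gamma a / (1 - a)) / Gamma (c + 1 - a).
Proof.
move=> a0 a1 c1; have bJ := factorially_bounded_clifford c1.
have J0 := clifford0 c.
have [K Ky HK] := mellin_is_cvgy a0 a1 bJ J0 (fun x => @clifford_le1 _ c x c1).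
have c0 : 0 < c by lra.
have ca0 : 0 < c + 1 - a by lra.
have r0 k : rising c k != 0 by rewrite gt_eqF// rising_gt0.
have coefE k : rising c k * mellin_coeff a (clifford c) k = mellin_coeff a exp_coeffN k.
  case: k => [|k] /=; first by rewrite mulr0.
  have ak : a + k%:R != 0 by rewrite gt_eqF// ltr_wpDr.
  rewrite /clifford /exp_coeffN; have := r0 k.+1.
  move: (rising c k.+1) ((k.+1)`!%:R^-1) ((-1) ^+ k.+1) => r f e rn.
  by field; rewrite rn ak.
have [C HC] := factorially_bounded_mellin a0 factorially_bounded_expN.
(* the integers q = n + 1 suffice, since both limits are known to exist *)
pose I n (s : R) := gamma_density (c + 1 - a) 1 s * mellin a (clifford c) (s * n.+1%:R).
have igK : mu.-integrable pos (EFin \o (fun s => K * gamma_density (c + 1 - a) 1 s)).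
  by have := @integrableZl _ _ _ mu pos (measurable_itv _) K _
    (integrable_gamma_density ca0 ltr01).
have Ile n s : 0 < s -> `|I n s| <= K * gamma_density (c + 1 - a) 1 s.
  move=> s0; have sn : 0 < s * n.+1%:R by rewrite mulr_gt0// ltr0n.
  have /andP[m0 mK] := HK _ sn.
  have g0 := gamma_density_ge0 (c + 1 - a) 1 s.
  by rewrite /I normrM (ger0_norm g0) (ger0_norm m0) mulrC ler_wpM2r.
have iI n : mu.-integrable pos (EFin \o I n).
  apply: (@le_integrable _ _ _ mu pos (measurable_itv _) _ _ _ _ igK).
    apply/measurable_EFinP; apply: measurable_fun_pos => s s0.
    have sn : 0 < s * n.+1%:R by rewrite mulr_gt0// ltr0n.
    apply: continuousM; first exact: continuous_gamma_density.
    apply: (@continuous_comp _ _ _ (fun s : R => s * n.+1%:R)).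
      exact: mulrr_continuous.
    exact: is_derive_continuous (mellin_is_derive a0 bJ J0 sn).
  move=> s; rewrite /= in_itv/= andbT => s0; rewrite lee_fin.
  by apply: le_trans (Ile n s s0) _; exact: ler_norm.
have HL n : \int[mu]_(s in pos) I n s = Gamma c * mellin a exp_coeffN n.+1%:R.
  have q0 : 0 < n.+1%:R :> R by rewrite ltr0n.
  have uC k : `|mellin_coeff a (clifford c) k| * k`!%:R * rising c k <= C.
    apply: le_trans (HC k); have rk : 0 < rising c k by exact: rising_gt0.
    rewrite -coefE normrM (gtr0_norm rk) (_ : _ * _ * rising c k =
      rising c k * `|mellin_coeff a (clifford c) k| * k`!%:R)//; ring.
  have L := laplace_psum c1 (ltW q0) uC.
  have IE : {in pos, (fun s => gamma_density c 1 s *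
      psum (mellin_coeff a (clifford c)) (s * n.+1%:R)) =1
      (fun s => n.+1%:R `^ (1 - a) * I n s)}.
    move=> s; rewrite inE/= in_itv/= andbT => s0.
    rewrite /I /mellin /gamma_density powRM ?(ltW s0) ?(ltW q0)//.
    rewrite (@powRDgt0 _ (c - 1) (c + 1 - a - 1) (a - 1) s)//; last by ring.
    have -> : 1 - a = - (a - 1) by ring.
    rewrite powRN; have : n.+1%:R `^ (a - 1) != 0 :> R by rewrite gt_eqF ?powR_gt0.
    by move=> qa; field.
  have pE : psum (fun k => rising c k * mellin_coeff a (clifford c) k) n.+1%:R =
      psum (mellin_coeff a exp_coeffN) n.+1%:R.
    by congr (psum _ _); exact/funext.
  rewrite (eq_Rintegral mu IE) RintegralZl// in L.
  rewrite /mellin mulrCA -pE -L mulrA -(@powRDgt0 _ 0 (a - 1) (1 - a))//; last by ring.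
  by rewrite powRr0 mul1r.
have lim1 : \int[mu]_(s in pos) I n s @[n --> \oo] -->
    \int[mu]_(s in pos) (K * gamma_density (c + 1 - a) 1 s).
  apply: (dominated_cvg_pos iI _ igK Ile) => s s0.
  rewrite mulrC; apply: cvgMr; move/cvg_pinftyP : Ky; apply.
  exact: cvg_mulrnat.
have lim2 : \int[mu]_(s in pos) I n s @[n --> \oo] --> Gamma c * (Gamma a / (1 - a)).
  under eq_fun do rewrite HL.
  apply: cvgMr; have /cvg_pinftyP := mellin_expN_cvgy a0 a1; apply.
  by under eq_fun do rewrite -[_.+1%:R]mul1r; exact: cvg_mulrnat.
have KE : K * Gamma (c + 1 - a) = Gamma c * (Gamma a / (1 - a)).
  rewrite GammaE -RintegralZl//; last exact: integrable_gamma_density.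
  exact: (cvg_unique _ lim1 lim2).
by rewrite -KE mulfK// gt_eqF// Gamma_gt0.
Qed.

End MellinLimit.

(** * Asymptotics of the hypergeometric function and of the eigenvalue *)

Section Asymptotics.
Context {R : realType}.
Implicit Types (a c z : R).

(** (1)_m / (2)_m = 1 / (m + 1) and (a)_m / (a + 1)_m = a / (a + m), so up to a
   shift of index the 2F3 is 0F1 with its coefficients divided by a - 1 + k. *)
Lemma hypergeometric_mellin a c z : 0 < a -> 1 <= c ->
  z * hypergeometric [:: 1; a] [:: 2; c + 1; a + 1] (- z) =
  c * a * psum (mellin_coeff a (clifford c)) z.
Proof.
move=> a0 c1; have c0 : 0 < c by lra.
have bm := factorially_bounded_mellin a0 (factorially_bounded_clifford c1).
have bv := factorially_boundedZ (c * a) bm.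
rewrite -(psumZ _ _ bm) (psum_shift z (factorially_bounded_shift bv))//; last first.
  by rewrite mulr0.
rewrite /hypergeometric /psum /pseries; congr (_ * _); congr (limn (series _)).
apply/funext => m /=.
rewrite !big_cons !big_nil !mulr1 exprNn [LHS]mulrA; congr (_ * _).
have am : 0 < a + m%:R by rewrite ltr_wpDr.
have ra := rising_gt0 m a0.
have ra1 : 0 < rising (a + 1) m by rewrite rising_gt0// ltr_wpDr.
have rc1 : 0 < rising (c + 1) m by rewrite rising_gt0// ltr_wpDr// ltW.
have f1 : 0 < m.+1`!%:R :> R by rewrite ltr0n fact_gt0.
have f0 : 0 < m`!%:R :> R by rewrite ltr0n fact_gt0.
have -> : rising (2 : R) m = m.+1`!%:R.
  by rewrite -rising1 risingSl mul1r; congr rising; ring.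
have raE : rising a m * (a + m%:R) = a * rising (a + 1) m.
  by rewrite -risingS risingSl.
have -> : rising a m = a * rising (a + 1) m / (a + m%:R).
  by rewrite -raE mulfK// gt_eqF.
rewrite rising1 /clifford risingSl exprS.
move: (m`!%:R : R) f0 (m.+1`!%:R : R) f1 (rising (a + 1) m) ra1 (rising (c + 1) m) rc1
  (a + m%:R) am ((-1) ^+ m) => *.
by field; rewrite !gt_eqF.
Qed.

(** Both regimes at once: the constant dominates the denominator if a > 1 and
   the power z^(1 - a) if a < 1. This is why the value of B only matters in
   the second regime. *)
Lemma mellin_clifford_powR a c (B : R) : 0 < a -> a != 1 -> 3 / 2 <= c ->
  (a < 1 -> B = c * a * (Gamma c * (Gamma a / (1 - a)) / Gamma (c + 1 - a))) ->
  c * a * psum (mellin_coeff a (clifford c)) z /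
    (c * a / (a - 1) + B * z `^ (1 - a)) @[z --> +oo] --> (1 : R).
Proof.
move=> a0 aN1 c32 BE; have c1 : 1 <= c by lra.
have ca0 : 0 < c * a by rewrite mulr_gt0//; lra.
have bJ := factorially_bounded_clifford c1.
have := aN1; rewrite neq_lt => /orP[a1|a1].
- have c0 : 0 < c by lra.
  have a1' : 0 < 1 - a by lra.
  have ca1 : 0 < c + 1 - a by lra.
  have L0 := divr_gt0 (mulr_gt0 (Gamma_gt0 c0) (divr_gt0 (Gamma_gt0 a0) a1'))
    (Gamma_gt0 ca1).
  have := mellin_clifford_cvgy a0 a1 c1; move: BE L0 => /(_ a1).
  move: (Gamma c * _ / _) => L BE L0 M.
  have B0 : B != 0 by rewrite BE gt_eqF// mulr_gt0.
  have h : c * a * mellin a (clifford c) z / (c * a / (a - 1) * z `^ (a - 1) + B)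
      @[z --> +oo] --> B / (c * a / (a - 1) * 0 + B).
    apply: cvgM; first by rewrite {1}BE; exact: cvgMr.
    apply: cvgV; first by rewrite mulr0 add0r.
    by apply: cvgD; [apply: cvgMr; apply: powR_cvgy0; lra|exact: cvg_cst].
  rewrite mulr0 add0r divff// in h.
  apply: cvg_trans h; apply: near_eq_cvg; near=> z; have z0 : 0 < z by [].
  have -> : 1 - a = - (a - 1) by ring.
  rewrite /mellin powRN; have : z `^ (a - 1) != 0 by rewrite gt_eqF ?powR_gt0.
  move: (z `^ (a - 1)) => p p0.
  have -> : c * a / (a - 1) * p + B = p * (c * a / (a - 1) + B / p).
    by field; rewrite p0 subr_eq0.
  by rewrite mulrCA -mulf_div divff// mul1r.
- have J0 := clifford_cvg0 c32.
  have M := mellin_cvg_gt1 a1 bJ (clifford0 c) J0.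
  have L0 : c * a / (a - 1) != 0 by rewrite gt_eqF// divr_gt0//; lra.
  have h : c * a * psum (mellin_coeff a (clifford c)) z /
    (c * a / (a - 1) + B * z `^ (1 - a)) @[z --> +oo] -->
    c * a / (a - 1) / (c * a / (a - 1) + B * 0).
    apply: cvgM; first exact: cvgMr.
    apply: cvgV; first by rewrite mulr0 addr0.
    by apply: cvgD; [exact: cvg_cst|apply: cvgMr; apply: powR_cvgy0; lra].
  by rewrite mulr0 addr0 divff in h.
Unshelve. all: by end_near. Qed.

(** Any additive constant k is absorbed, as the logarithm diverges. *)
Lemma mellin_clifford_ln c (k : R) : 3 / 2 <= c ->
  c * psum (mellin_coeff 1 (clifford c)) z / (c * (ln z + k)) @[z --> +oo] --> (1 : R).
Proof.
move=> c32; have c1 : 1 <= c by lra.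
have bJ := factorially_bounded_clifford c1.
have M := mellin_cvg_eq1 bJ (clifford0 c) (clifford_cvg0 c32).
have iln : (ln z)^-1 @[z --> +oo] --> (0 : R).
  apply/gtr0_cvgV0; last exact: ln_cvgy.
  by near=> z; rewrite ln_gt0.
have h : psum (mellin_coeff 1 (clifford c)) z / ln z / (1 + k * (ln z)^-1)
    @[z --> +oo] --> 1 / (1 + k * 0).
  apply: cvgM => //; apply: cvgV; first by rewrite mulr0 addr0 oner_neq0.
  by apply: cvgD; [exact: cvg_cst|exact: cvgMr].
rewrite mulr0 addr0 divr1 in h; apply: cvg_trans h; apply: near_eq_cvg; near=> z.
have lz : 0 < ln z by rewrite ln_gt0.
have -> : 1 + k * (ln z)^-1 = (ln z + k) / ln z by field; rewrite gt_eqF.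
rewrite -[RHS]mulf_div divff ?mul1r; last lra.
by rewrite invfM invrK mulrA mulrAC divfK// gt_eqF.
Unshelve. all: by end_near. Qed.

Lemma enorm_cvgy n : enorm v @[v --> @enorm_infty R n] --> +oo.
Proof. by apply/cvgryPgt => A; exists A. Qed.

Lemma scaled_cvgy n (delta : R) : 0 < delta ->
  4^-1 * enorm v ^+ 2 * delta ^+ 2 @[v --> @enorm_infty R n] --> +oo.
Proof.
move=> d0; apply/cvgryPge => A.
have d4 : 0 < 4^-1 * delta ^+ 2 by rewrite mulr_gt0 ?exprn_gt0.
have /cvgryPge/(_ (Num.max 1 (A / (4^-1 * delta ^+ 2)))) := @enorm_cvgy n.
apply: filterS => v; rewrite ge_max => /andP[v1 vA].
rewrite mulrAC mulrC -ler_pdivrMr//; apply: le_trans vA _.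
by rewrite expr2 ler_peMr// (le_trans ler01).
Qed.

Lemma lambda2E n (mu delta beta : R) (nu : 'rV[R]_n) : 0 < delta ->
  beta < n%:R + 2 ->
  let a := (n%:R + 2 - beta) / 2 in let c := (n%:R + 2) / 2 in
  lambda2 mu delta beta nu = - mu * (4 / delta ^+ 2) *
    (c * a * psum (mellin_coeff a (clifford c)) (4^-1 * enorm nu ^+ 2 * delta ^+ 2)).
Proof.
move=> d0 bn a c; have a0 : 0 < a by rewrite /a; lra.
have n0 : 0 <= n%:R :> R by [].
have c1 : 1 <= c by rewrite /c; lra.
rewrite -(hypergeometric_mellin _ a0 c1) /lambda2.
have -> : (n%:R + 4) / 2 = c + 1 by rewrite /c; field.
have -> : (n%:R + 4 - beta) / 2 = a + 1 by rewrite /a; field.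
have -> : - 4^-1 * enorm nu ^+ 2 * delta ^+ 2 =
  - (4^-1 * enorm nu ^+ 2 * delta ^+ 2) by ring.
rewrite -/a; move: (hypergeometric _ _ _) => H; field; lra.
Qed.

End Asymptotics.

Theorem theorem6 (R : realType) (n : nat) (mu delta beta : R)
    (n_ge1 : (1 <= n)%N) (mu_gt0 : 0 < mu) (delta_gt0 : 0 < delta)
    (beta_lt : beta < n%:R + 2) :
  (beta <> n%:R ->
     asymp_equiv (fun nu : 'rV[R]_n => lambda2 mu delta beta nu)
       (fun nu : 'rV[R]_n =>
          - mu * (2 * (n%:R + 2 - beta) * (n%:R + 2)
                  / (delta ^+ 2 * (n%:R - beta)))
          - mu * (Gamma ((n%:R + 4) / 2) * Gamma ((n%:R + 4 - beta) / 2)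
                  / ((beta - n%:R) / 2) * rGamma ((beta + 2) / 2))
            * (2 / delta) `^ (n%:R + 2 - beta)
            * enorm nu `^ (beta - n%:R))) /\
  (beta = n%:R ->
     asymp_equiv (fun nu : 'rV[R]_n => lambda2 mu delta beta nu)
       (fun nu : 'rV[R]_n =>
          - (2 * mu / delta ^+ 2) * (n%:R + 2)
          * (2 * ln (enorm nu) + ln (delta ^+ 2 / 4)
             + Euler_gamma - digamma ((n%:R + 2) / 2)))).
Proof.
pose a := (n%:R + 2 - beta) / 2; pose c := (n%:R + 2) / 2 : R.
have n1 : 1 <= n%:R :> R by rewrite ler1n.
have c32 : 3 / 2 <= c by rewrite /c; lra.
have a0 : 0 < a by rewrite /a; lra.
have aE : n%:R + 2 - beta = 2 * a by rewrite /a; field.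
have cE : n%:R + 2 = 2 * c by rewrite /c; field.
have abE : beta - n%:R = 2 * (1 - a) by rewrite /a; field.
have s0 : - mu * (4 / delta ^+ 2) != 0.
  by rewrite mulNr oppr_eq0 gt_eqF// mulr_gt0// divr_gt0// exprn_gt0.
split=> [betaN|betaE]; rewrite /asymp_equiv.
- have aN1 : a != 1.
    by apply/eqP => a1; apply: betaN; move: abE; rewrite a1; lra.
  have -> : (n%:R + 4) / 2 = c + 1 by rewrite /c; field.
  have -> : (n%:R + 4 - beta) / 2 = a + 1 by rewrite /a; field.
  have -> : (beta + 2) / 2 = c + 1 - a by rewrite /a /c; field.
  have -> : (beta - n%:R) / 2 = 1 - a by rewrite abE; field.
  have -> : n%:R - beta = 2 * (a - 1) by rewrite /a; field.
  rewrite aE cE abE.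
  set B := Gamma (c + 1) * Gamma (a + 1) / (1 - a) * rGamma (c + 1 - a).
  have BE : a < 1 -> B = c * a * (Gamma c * (Gamma a / (1 - a)) / Gamma (c + 1 - a)).
    move=> a1; rewrite /B rGamma_gt0; last lra.
    rewrite !Gamma_functional//; last lra.
    by move: (Gamma c) (Gamma a) (Gamma _)^-1 => g h k; field; lra.
  have h := @cvg_comp _ _ _ _ _ _ _ _ (@scaled_cvgy R n delta delta_gt0)
    (mellin_clifford_powR a0 aN1 c32 BE).
  apply: cvg_trans h; apply: near_eq_cvg.
  have /cvgryPgt/(_ 0) := @enorm_cvgy R n; apply: filterS => v v0.
  rewrite lambda2E// -/a -/c /=; set z := 4^-1 * _ * _.
  have zE : (2 / delta) `^ (2 * a) * enorm v `^ (2 * (1 - a)) =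
      4 / delta ^+ 2 * z `^ (1 - a).
    have h0 : 0 < 2 / delta by rewrite divr_gt0.
    have -> : z = (2 / delta) `^ (- 2) * enorm v `^ 2.
      rewrite powRN !(@powR_mulrn _ _ 2) ?ltW// /z.
      by field; rewrite gt_eqF.
    have -> : 4 / delta ^+ 2 = (2 / delta) `^ 2.
      by rewrite (@powR_mulrn _ _ 2) ?ltW//; field; rewrite gt_eqF.
    rewrite powRM ?powR_ge0// -!powRrM [RHS]mulrA; congr (_ * _).
    by apply: powRDgt0 => //; ring.
  rewrite -[mu * B * _ * _]mulrA zE.
  have -> : - mu * (2 * (2 * a) * (2 * c) / (delta ^+ 2 * (2 * (a - 1)))) -
      mu * B * (4 / delta ^+ 2 * z `^ (1 - a)) =
      - mu * (4 / delta ^+ 2) * (c * a / (a - 1) + B * z `^ (1 - a)).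
    by field; rewrite subr_eq0 aN1 gt_eqF.
  by rewrite -[RHS]mulf_div divff// mul1r.
- have a1 : a = 1 by rewrite /a betaE; field.
  pose k : R := Euler_gamma - digamma c.
  have h := @cvg_comp _ _ _ _ _ _ _ _ (@scaled_cvgy R n delta delta_gt0)
    (mellin_clifford_ln k c32).
  apply: cvg_trans h; apply: near_eq_cvg.
  have /cvgryPgt/(_ 0) := @enorm_cvgy R n; apply: filterS => v v0.
  rewrite lambda2E// -/a -/c /=; set z := 4^-1 * _ * _.
  have lnz : 2 * ln (enorm v) + ln (delta ^+ 2 / 4) = ln z.
    have -> : z = enorm v ^+ 2 * (delta ^+ 2 / 4) by rewrite /z; field.
    rewrite [RHS]lnM ?posrE ?divr_gt0 ?exprn_gt0// (lnXn 2 v0) mulr2n.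
    by congr (_ + _); ring.
  rewrite -[_ + Euler_gamma - _]addrA -/k lnz cE a1 mulr1.
  have -> : - (2 * mu / delta ^+ 2) * (2 * c) = - mu * (4 / delta ^+ 2) * c.
    by field; rewrite gt_eqF.
  by rewrite -[X in _ = _ / X]mulrA -[RHS]mulf_div divff// mul1r.
Qed.
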